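(* Let $\alpha=[a_0;a_1,a_2,\dots]$ be irrational with $\sup_{k \ge 1} a_k = \infty$, with convergent denominators $q_k$. Then \[ P_{q_{k_m}} (\alpha, (-1)^{k_m} x/q_{k_m}) \to |2 \sin (\pi x)| \qquad \text{as } m \to \infty \] locally uniformly in $x\in\mathbb{R}$, for any increasing sequence of positive integers $k_m$ such that \[ \frac{1+\log \max_{1 \le \ell \le k_m} a_{\ell}}{a_{k_m+1}} \to 0 \qquad \text{as } m \to \infty . \] If in addition $\lim_{k \to \infty} (1+\log a_k)/a_{k+1}=0$, then the same holds along the full sequence $k_m=m$.
   Context: For real $\alpha,x$ and integer $N\ge0$, $P_N(\alpha,x)=\prod_{n=1}^N|2\sin(\pi(n\alpha+x))|$. $q_k$ are the denominators of the convergents $[a_0;a_1,\dots,a_k]$ of $\alpha$. *)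

(* Defs.v *)
From Stdlib Require Import Reals Lra Lia ZArith.
Open Scope R_scope.

Definition floorR (x : R) : R := IZR (Int_part x).

Fixpoint cf_x (alpha : R) (k : nat) : R :=
  match k with
  | O => alpha
  | S k' => / (cf_x alpha k' - floorR (cf_x alpha k'))
  end.

Definition cf_a (alpha : R) (k : nat) : R := floorR (cf_x alpha k).

(* Convergent denominators: q_{-1} = 0, q_0 = 1, q_{k+1} = a_{k+1} q_k + q_{k-1}.
   cf_q_pair alpha k = (q_{k-1}, q_k). *)
Fixpoint cf_q_pair (alpha : R) (k : nat) : nat * nat :=
  match k with
  | O => (0%nat, 1%nat)
  | S k' => let (qm, q) := cf_q_pair alpha k' in
            (q, (Z.to_nat (Int_part (cf_x alpha (S k'))) * q + qm)%nat)
  end.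

Definition cf_q (alpha : R) (k : nat) : nat := snd (cf_q_pair alpha k).

Fixpoint cf_amax (alpha : R) (k : nat) : R :=
  match k with
  | O => 0
  | S O => cf_a alpha 1
  | S k' => Rmax (cf_amax alpha k') (cf_a alpha k)
  end.

Fixpoint P (N : nat) (alpha x : R) : R :=
  match N with
  | O => 1
  | S N' => P N' alpha x * Rabs (2 * sin (PI * (INR N * alpha + x)))
  end.

Definition irrational (alpha : R) : Prop :=
  forall (p q : Z), q <> 0%Z -> alpha <> IZR p / IZR q.

Definition loc_unif_cv (f : nat -> R -> R) (g : R -> R) : Prop :=
  forall M eps : R, 0 < eps -> exists N : nat, forall m : nat, (N <= m)%nat ->
    forall x : R, Rabs x <= M -> Rabs (f m x - g x) < eps.

(* Main.v *)
(** Write [q], [p] for the denominator and numerator of the [k]-th convergent,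
    [q'] for the previous denominator, [r = q' / q], [psi t = {t} - 1/2] and
    [eta = q |q alpha - p| <= 1 / a_(k+1)].  After the reindexing [m = (-1)^k p n]
    modulo [q], the factors of [P_q(alpha, (-1)^k x / q)] become
    [|2 sin (pi (m + x + eta/2 - eta psi (m r)) / q)|]: this is the classical
    product [prod_m |2 sin (pi (m + y) / q)| = |2 sin (pi y)|] at [y = x + eta/2],
    with the [m]-th node moved by [eta psi (m r) / q].  To first order the logarithm
    changes by [eta sum_m psi (m r) (pi / q) cot (pi (m + y) / q)], apart from the
    node closest to a zero, which is treated separately.  By Abel summation this is
    controlled by the sums [A_n = sum_(i < n) psi (z + i r)] with weights [1/n^2].
    The convergent denominators [Q_j] of [r = [0; a_k, ..., a_1]] satisfy
    [A_(Q_j) = O(1)] uniformly in [z], which makes the weighted sum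
    [O (sum_j (1 + log a_(k-j)) / Q_j) = O (sum_(l <= k) (q_l / q_k) (1 + log a_l))].
    Dividing by [a_(k+1)] and using the geometric growth of [q_l] (and
    [a_(l+1) q_l <= q_(l+1)] for the full sequence), this tends to [0]. *)

Require Import Defs.
From Stdlib Require Import Reals Lra Lia ZArith Znumtheory List Permutation.
From mathcomp Require all_boot all_algebra Rstruct complex.
Open Scope R_scope.

(** * Finite sums and products *)

Fixpoint sumN (f : nat -> R) (n : nat) : R :=
  match n with O => 0 | S n' => sumN f n' + f n' end.

Fixpoint prodN (f : nat -> R) (n : nat) : R :=
  match n with O => 1 | S n' => prodN f n' * f n' end.

Lemma sumN_ext (f g : nat -> R) (n : nat) :
  (forall i, (i < n)%nat -> f i = g i) -> sumN f n = sumN g n.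
Proof.
  induction n as [|n IH]; simpl; intros H; [reflexivity|].
  rewrite IH, H; auto.
Qed.

Lemma sumN_le (f g : nat -> R) (n : nat) :
  (forall i, (i < n)%nat -> f i <= g i) -> sumN f n <= sumN g n.
Proof.
  induction n as [|n IH]; simpl; intros H; [lra|].
  apply Rplus_le_compat; auto.
Qed.

Lemma sumN_plus (f g : nat -> R) (n : nat) :
  sumN (fun i => f i + g i) n = sumN f n + sumN g n.
Proof. induction n as [|n IH]; simpl; [ring|rewrite IH; ring]. Qed.

Lemma sumN_scal (c : R) (f : nat -> R) (n : nat) :
  sumN (fun i => c * f i) n = c * sumN f n.
Proof. induction n as [|n IH]; simpl; [ring|rewrite IH; ring]. Qed.

Lemma sumN_const (c : R) (n : nat) : sumN (fun _ => c) n = INR n * c.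
Proof. induction n as [|n IH]; [simpl; ring|]. rewrite S_INR; simpl; rewrite IH; ring. Qed.

Lemma sumN_Rabs (f : nat -> R) (n : nat) :
  Rabs (sumN f n) <= sumN (fun i => Rabs (f i)) n.
Proof.
  induction n as [|n IH]; simpl; [rewrite Rabs_R0; lra|].
  eapply Rle_trans; [apply Rabs_triang|lra].
Qed.

Lemma sumN_add (f : nat -> R) (n m : nat) :
  sumN f (n + m) = sumN f n + sumN (fun i => f (n + i)%nat) m.
Proof.
  induction m as [|m IH]; [rewrite Nat.add_0_r; simpl; ring|].
  rewrite Nat.add_succ_r; simpl; rewrite IH; ring.
Qed.

Lemma sumN_ge0 (f : nat -> R) (n : nat) : (forall i, (i < n)%nat -> 0 <= f i) -> 0 <= sumN f n.
Proof.
  induction n as [|n IH]; simpl; intros H; [lra|]. apply Rplus_le_le_0_compat; auto.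
Qed.

Lemma sumN_le_len (f : nat -> R) (n m : nat) :
  (forall i, 0 <= f i) -> (n <= m)%nat -> sumN f n <= sumN f m.
Proof.
  intros H L; replace m with (n + (m - n))%nat by lia.
  rewrite sumN_add; pose proof (sumN_ge0 (fun i => f (n + i)%nat) (m - n)); auto.
  assert (0 <= sumN (fun i => f (n + i)%nat) (m - n)) by auto. lra.
Qed.

Lemma sumN_rev (f : nat -> R) (n : nat) :
  sumN (fun i => f (n - 1 - i)%nat) n = sumN f n.
Proof.
  revert f; induction n as [|n IH]; intros f; [reflexivity|].
  change (sumN f (S n)) with (sumN f (1 + n)); rewrite sumN_add.
  rewrite <- (IH (fun i => f (1 + i)%nat)).
  change (sumN (fun i => f (S n - 1 - i)%nat) (S n)) with
    (sumN (fun i => f (S n - 1 - i)%nat) n + f (S n - 1 - n)%nat).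
  replace (S n - 1 - n)%nat with O by lia.
  rewrite (sumN_ext (fun i => f (S n - 1 - i)%nat) (fun i => f (1 + (n - 1 - i))%nat)).
  - simpl; ring.
  - intros i Hi; f_equal; lia.
Qed.

(** Summation by parts. It trades the weights [c] for their increments, which decay fast enough to
    be paired with the partial sums of [f]. *)
Lemma abel_summation (f c : nat -> R) (m : nat) :
  sumN (fun i => f i * c i) (S m)
  = sumN (fun i => sumN f (1 + i) * (c i - c (S i))) m + sumN f (S m) * c m.
Proof.
  induction m as [|m IH]; [simpl; ring|].
  change (sumN (fun i => f i * c i) (S (S m)))
    with (sumN (fun i => f i * c i) (S m) + f (S m) * c (S m)).
  rewrite IH; cbn [sumN Nat.add]; ring.
Qed.

Lemma prodN_ext (f g : nat -> R) (n : nat) :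
  (forall i, (i < n)%nat -> f i = g i) -> prodN f n = prodN g n.
Proof.
  induction n as [|n IH]; simpl; intros H; [reflexivity|].
  rewrite IH, H; auto.
Qed.

Lemma prodN_ge0 (f : nat -> R) (n : nat) :
  (forall i, (i < n)%nat -> 0 <= f i) -> 0 <= prodN f n.
Proof.
  induction n as [|n IH]; simpl; intros H; [lra|]. apply Rmult_le_pos; auto.
Qed.

Lemma prodN_mult (f g : nat -> R) (n : nat) :
  prodN (fun i => f i * g i) n = prodN f n * prodN g n.
Proof. induction n as [|n IH]; simpl; [ring|rewrite IH; ring]. Qed.

Lemma prodN_add (f : nat -> R) (n m : nat) :
  prodN f (n + m) = prodN f n * prodN (fun i => f (n + i)%nat) m.
Proof.
  induction m as [|m IH]; [rewrite Nat.add_0_r; simpl; ring|].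
  rewrite Nat.add_succ_r; simpl; rewrite IH; ring.
Qed.

Lemma prodN_rev (f : nat -> R) (n : nat) :
  prodN (fun i => f (n - 1 - i)%nat) n = prodN f n.
Proof.
  revert f; induction n as [|n IH]; intros f; [reflexivity|].
  change (prodN f (S n)) with (prodN f (1 + n)); rewrite prodN_add.
  rewrite <- (IH (fun i => f (1 + i)%nat)).
  change (prodN (fun i => f (S n - 1 - i)%nat) (S n)) with
    (prodN (fun i => f (S n - 1 - i)%nat) n * f (S n - 1 - n)%nat).
  replace (S n - 1 - n)%nat with O by lia.
  rewrite (prodN_ext (fun i => f (S n - 1 - i)%nat) (fun i => f (1 + (n - 1 - i))%nat)).
  - simpl; ring.
  - intros i Hi; f_equal; lia.
Qed.

Lemma prodN_head (F : nat -> R) (n : nat) : (1 <= n)%nat ->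
  prodN F n = F 0%nat * prodN (fun i => F (1 + i)%nat) (n - 1).
Proof.
  intros H; replace n with (1 + (n - 1))%nat at 1 by lia.
  rewrite prodN_add; cbn [prodN]; ring.
Qed.

(** * Reindexing by an affine map of the residues modulo [q] *)

Section Reindex.

Variables (q u c : Z).
Hypothesis q_pos : (0 < q)%Z.
Hypothesis coprime_u : rel_prime u q.

Let idx (i : nat) : nat := Z.to_nat ((u * Z.of_nat i + c) mod q).

(** Injectivity suffices on a finite set: equal residues give [q | u (i - j)], Gauss removes the
    coprime [u], and [|i - j| < q] forces [i = j]. *)
Lemma affine_residues_permutation :
  Permutation (map idx (seq 0 (Z.to_nat q))) (seq 0 (Z.to_nat q)).
Proof.
  apply NoDup_Permutation_bis.
  - apply NoDup_map_NoDup_ForallPairs; [|apply seq_NoDup].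
    intros i j Hi Hj E.
    apply in_seq in Hi; apply in_seq in Hj; unfold idx in E.
    assert (E' : ((u * Z.of_nat i + c) mod q = (u * Z.of_nat j + c) mod q)%Z).
    { apply Z2Nat.inj in E; auto; apply Z.mod_pos_bound; assumption. }
    assert (D : (q | u * (Z.of_nat i - Z.of_nat j))%Z).
    { apply Z.mod_divide; [lia|].
      replace (u * (Z.of_nat i - Z.of_nat j))%Z
        with ((u * Z.of_nat i + c) - (u * Z.of_nat j + c))%Z by ring.
      rewrite Zminus_mod, E', Z.sub_diag; apply Z.mod_0_l; lia. }
    apply Gauss in D; [|apply rel_prime_sym; assumption].
    destruct D as [d Hd]. assert (B : (- q < d * q < q)%Z) by lia.
    assert (d = 0)%Z by nia. lia.
  - rewrite length_map; lia.
  - intros x Hx. apply in_map_iff in Hx as [i [<- _]].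
    apply in_seq; unfold idx.
    pose proof (Z.mod_pos_bound (u * Z.of_nat i + c) q q_pos); lia.
Qed.

Variable F : Z -> R.
Hypothesis F_periodic : forall m, F (m mod q)%Z = F m.

Lemma reindex_map :
  Permutation (map (fun i => F (u * Z.of_nat i + c)%Z) (seq 0 (Z.to_nat q)))
              (map (fun i => F (Z.of_nat i)) (seq 0 (Z.to_nat q))).
Proof.
  replace (map (fun i => F (u * Z.of_nat i + c)%Z) (seq 0 (Z.to_nat q)))
    with (map (fun i => F (Z.of_nat i)) (map idx (seq 0 (Z.to_nat q)))).
  - apply Permutation_map, affine_residues_permutation.
  - rewrite map_map; apply map_ext; intros i; unfold idx.
    rewrite Z2Nat.id; [apply F_periodic|apply Z.mod_pos_bound; assumption].
Qed.

Lemma sumN_reindex :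
  sumN (fun i => F (u * Z.of_nat i + c)%Z) (Z.to_nat q)
  = sumN (fun i => F (Z.of_nat i)) (Z.to_nat q).
Proof.
  assert (L : forall (l l' : list R), Permutation l l' ->
            fold_right Rplus 0 l = fold_right Rplus 0 l').
  { induction 1; simpl; lra. }
  assert (E : forall f n, sumN f n = fold_right Rplus 0 (map f (seq 0 n))).
  { intros f n; induction n as [|n IH]; [reflexivity|].
    rewrite seq_S, map_app, fold_right_app; simpl; rewrite IH.
    generalize (map f (seq 0 n)); intros l; induction l; simpl; lra. }
  rewrite !E; apply L, reindex_map.
Qed.

Lemma prodN_reindex :
  prodN (fun i => F (u * Z.of_nat i + c)%Z) (Z.to_nat q)
  = prodN (fun i => F (Z.of_nat i)) (Z.to_nat q).
Proof.
  assert (L : forall (l l' : list R), Permutation l l' ->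
            fold_right Rmult 1 l = fold_right Rmult 1 l').
  { induction 1; simpl; try nra; congruence. }
  assert (E : forall f n, prodN f n = fold_right Rmult 1 (map f (seq 0 n))).
  { intros f n; induction n as [|n IH]; [reflexivity|].
    rewrite seq_S, map_app, fold_right_app; simpl; rewrite IH.
    generalize (map f (seq 0 n)); intros l; induction l as [|a l IHl]; simpl; [ring|].
    rewrite <- IHl; ring. }
  rewrite !E; apply L, reindex_map.
Qed.

End Reindex.

(** * The product formula for the sine *)

Module SineProduct.
Import all_boot all_algebra Rstruct complex.
Import GRing.Theory.
Local Delimit Scope R_scope with coqR.

Definition cis (t : R) : complex R := Complex (cos t) (sin t).

(** The squared modulus is multiplicative and polynomial in the coordinates, so no square root has
    to be handled. *)
Definition normsq (z : complex R) : R :=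
  (complex.Re z * complex.Re z + complex.Im z * complex.Im z)%coqR.

Lemma cisD (s t : R) : cis (s + t)%coqR = (cis s * cis t)%R.
Proof.
rewrite /cis cos_plus sin_plus; congr Complex.
change ((sin s * cos t + cos s * sin t)%coqR = (cos s * sin t + sin s * cos t)%coqR).
lra.
Qed.

Lemma cis0 : cis 0%coqR = 1%R.
Proof. by rewrite /cis cos_0 sin_0. Qed.

Lemma cisX (t : R) (n : nat) : (cis t ^+ n)%R = cis (INR n * t)%coqR.
Proof.
elim: n => [|n IH].
  by rewrite expr0 Rmult_0_l cis0.
rewrite exprS IH -cisD S_INR; congr cis; lra.
Qed.

Lemma normsqM (z w : complex R) : normsq (z * w)%R = (normsq z * normsq w)%coqR.
Proof.
case: z => a b; case: w => c d; rewrite /normsq /=.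
change (((a*c-b*d)*(a*c-b*d) + (a*d+b*c)*(a*d+b*c))%coqR = ((a*a+b*b)*(c*c+d*d))%coqR).
ring.
Qed.

(** The chord between two points of the unit circle at angle [s - t] has length
    [|2 sin ((s - t) / 2)|]. *)
Lemma normsq_cisB (s t : R) :
  normsq (cis s - cis t)%R = Rsqr (2 * sin ((s - t) / 2))%coqR.
Proof.
have -> : normsq (cis s - cis t)%R =
  ((cos s - cos t) * (cos s - cos t) + (sin s - sin t) * (sin s - sin t))%coqR by [].
have E : ((cos s - cos t) * (cos s - cos t) + (sin s - sin t) * (sin s - sin t))%coqR
   = (2 - 2 * cos (s - t))%coqR.
  rewrite cos_minus; move: (sin2_cos2 s) (sin2_cos2 t); rewrite /Rsqr => *; lra.
rewrite E; have -> : (s - t = 2 * ((s - t) / 2))%coqR by lra.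
rewrite cos_2a_sin /Rsqr; set u := ((2 * _ / 2))%coqR.
have -> : u = ((s - t) / 2)%coqR by rewrite /u; field.
ring.
Qed.

(** The order [m] divides [q]. If [m < q], then [u = PI m / q] lies strictly between 0 and [PI], so
    [cos (2 u) = 1 - 2 sin^2 u < 1], contradicting that the [m]-th power is 1. *)
Lemma cis_primitive_root (q : nat) : (0 < q)%N ->
  primitive_root_of_unity q (cis (2 * PI / INR q)%coqR).
Proof.
move=> q0.
have qR : (0 < INR q)%coqR by apply: lt_0_INR; apply/ltP.
have E : (cis (2 * PI / INR q)%coqR ^+ q)%R = 1%R.
  rewrite cisX; have -> : (INR q * (2 * PI / INR q) = 2 * PI)%coqR by field; lra.
  by rewrite /cis cos_2PI sin_2PI.
have [m pm dm] := prim_order_exists q0 E.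
suff mq : m = q by move: pm; rewrite {1}mq.
have m0 := prim_order_gt0 pm.
have := prim_expr_order pm; rewrite cisX => -[Ec _].
apply/eqP; rewrite eqn_leq (dvdn_leq q0 dm) /= leqNgt; apply/negP => /ltP /lt_INR lmq.
have m1 : (0 < INR m)%coqR by apply: lt_0_INR; apply/ltP.
have P0 := PI_RGT_0.
set u := (PI * (INR m / INR q))%coqR.
have [u0 u1] : (0 < u < PI)%coqR.
  have h : (0 < INR m / INR q < 1)%coqR.
    split; first by apply: Rdiv_lt_0_compat.
    by apply: (Rmult_lt_reg_r (INR q)) => //; rewrite /Rdiv Rmult_assoc Rinv_l; lra.
  rewrite /u; nra.
have s0 := sin_gt_0 _ u0 u1.
have E2 : (INR m * (2 * PI / INR q) = 2 * u)%coqR by rewrite /u; field; lra.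
move: Ec; rewrite E2 cos_2a_sin.
by move=> Ec; have : (1 - 2 * sin u * sin u = 1)%coqR by []; nra.
Qed.

(** Evaluate [X^q - 1 = prod_i (X - zeta^i)] at [w = cis (- 2 PI y / q)] and take squared moduli:
    every factor, and [w^q - 1] itself, is a chord. Both sides being nonnegative, the squares can be
    removed. *)
Lemma prod_sin (q : nat) (y : R) : (1 <= q)%coq_nat ->
  prodN (fun m => Rabs (2 * sin (PI * (INR m + y) / INR q)))%coqR q
  = Rabs (2 * sin (PI * y))%coqR.
Proof.
move=> /leP q0.
have qR : (0 < INR q)%coqR by apply: lt_0_INR; apply/ltP.
set w := cis (- (2 * PI * y / INR q))%coqR.
have := factor_Xn_sub_1 (cis_primitive_root q q0).
move/(congr1 (fun p => normsq (horner p w))).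
rewrite horner_prod hornerD hornerXn hornerN hornerC.
have -> : normsq (w ^+ q - 1)%R = Rsqr (2 * sin (PI * y))%coqR.
  rewrite cisX -cis0 normsq_cisB.
  have -> : ((INR q * - (2 * PI * y / INR q) - 0) / 2 = - (PI * y))%coqR by field; lra.
  rewrite sin_neg /Rsqr; ring.
have H n : normsq (\prod_(0 <= i < n) horner ('X - (cis (2 * PI / INR q)%coqR ^+ i)%:P) w)%R
  = Rsqr (prodN (fun m => Rabs (2 * sin (PI * (INR m + y) / INR q)))%coqR n).
  elim: n => [|n IH].
    by rewrite big_geq //= /normsq /= /Rsqr; change ((1 * 1 + 0 * 0 = 1 * 1)%coqR); ring.
  rewrite big_nat_recr //= normsqM IH Rsqr_mult; congr Rmult.
  rewrite hornerD hornerX hornerN hornerC cisX normsq_cisB -Rsqr_abs.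
  rewrite [in RHS]Rsqr_neg; congr Rsqr.
  have -> : ((- (2 * PI * y / INR q) - INR n * (2 * PI / INR q)) / 2
     = - (PI * (INR n + y) / INR q))%coqR by field; lra.
  rewrite sin_neg; ring.
rewrite H (Rsqr_abs (2 * _)).
apply: Rsqr_inj; last exact: Rabs_pos.
by apply: prodN_ge0 => i _; exact: Rabs_pos.
Qed.

End SineProduct.

(** * The sawtooth sum over a block of convergent length *)

Lemma Rabs_le_bounds (a b : R) : Rabs a <= b -> - b <= a <= b.
Proof.
  intros H; pose proof (Rle_abs a); pose proof (Rle_abs (- a)) as H'.
  rewrite Rabs_Ropp in H'; lra.
Qed.

Lemma frac_part_unique (t : R) (n : Z) : 0 <= t - IZR n < 1 -> frac_part t = t - IZR n.
Proof.
  intros H; unfold frac_part.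
  pose proof (base_Int_part t) as B.
  assert (Int_part t = n) as ->; [|reflexivity].
  assert (Int_part t < n + 1)%Z by (apply lt_IZR; rewrite plus_IZR; lra).
  assert (n < Int_part t + 1)%Z by (apply lt_IZR; rewrite plus_IZR; lra).
  lia.
Qed.

Lemma frac_part_bounds (t : R) : 0 <= frac_part t < 1.
Proof. destruct (base_fp t); lra. Qed.

Lemma frac_part_shift (t : R) (n : Z) : frac_part (t + IZR n) = frac_part t.
Proof.
  pose proof (frac_part_bounds t) as B.
  rewrite (frac_part_unique (t + IZR n) (Int_part t + n)); unfold frac_part in *;
    rewrite plus_IZR; lra.
Qed.

(** The sawtooth, with value [- / 2] (not 0) at the integers. *)
Definition psi (t : R) : R := frac_part t - / 2.

Lemma psi_shift (t : R) (n : Z) : psi (t + IZR n) = psi t.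
Proof. unfold psi; rewrite frac_part_shift; reflexivity. Qed.

Lemma psi_bound (t : R) : Rabs (psi t) <= / 2.
Proof.
  unfold psi; pose proof (frac_part_bounds t); apply Rabs_le; lra.
Qed.

Definition psi_sum (r z : R) (n : nat) : R := sumN (fun i => psi (z + INR i * r)) n.

Lemma psi_sum_add (r z : R) (n m : nat) :
  psi_sum r z (n + m) = psi_sum r z n + psi_sum r (z + INR n * r) m.
Proof.
  unfold psi_sum; rewrite sumN_add; f_equal.
  apply sumN_ext; intros i _; f_equal; rewrite plus_INR; ring.
Qed.

Lemma sumN_indicator (k : Z) (n : nat) :
  sumN (fun i => if (Z.of_nat i =? k)%Z then 1 else 0) n <= 1.
Proof.
  (* The induction records whether [k] lies below [n]; without this the next index could contribute
     a second 1. *)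
  assert (H : sumN (fun i => if (Z.of_nat i =? k)%Z then 1 else 0) n
              <= if (k <? Z.of_nat n)%Z then 1 else 0).
  { induction n as [|n IH].
    - simpl; destruct (k <? 0)%Z; lra.
    - cbn [sumN]; revert IH.
      destruct (Z.eqb_spec (Z.of_nat n) k), (Z.ltb_spec k (Z.of_nat n)),
        (Z.ltb_spec k (Z.of_nat (S n))); try lia; lra. }
  destruct (k <? Z.of_nat n)%Z; lra.
Qed.

Lemma sumN_id (n : nat) : 2 * sumN (fun i => IZR (Z.of_nat i)) n = INR n * (INR n - 1).
Proof.
  induction n as [|n IH]; [simpl; ring|].
  rewrite S_INR; cbn [sumN]; rewrite <- INR_IZR_INZ.
  rewrite Rmult_plus_distr_l, IH; ring.
Qed.

Section Block.

Variables (Q N : Z) (r : R).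
Hypothesis level_pos : (0 < Q)%Z.
Hypothesis coprime_N : rel_prime N Q.
Hypothesis approx : Rabs (IZR Q * r - IZR N) <= / IZR Q.

(* Modulo 1, [z + i r] lies within [2 / Q] of the grid point [m / Q], where
   [m = N i + floor (z Q)] runs through all residues; only [m = 0] and [m = Q - 1]
   can wrap around, which costs at most 1 each. *)
Let centre (m : Z) : R := IZR (m mod Q) / IZR Q - / 2.
Let error (m : Z) : R :=
  2 / IZR Q + ((if (m mod Q =? 0)%Z then 1 else 0)
  + (if (m mod Q =? Q - 1)%Z then 1 else 0)).

Lemma psi_near_centre (z : R) (i : Z) : (0 <= i < Q)%Z ->
  Rabs (psi (z + IZR i * r) - centre (N * i + Int_part (z * IZR Q)))
  <= error (N * i + Int_part (z * IZR Q)).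
Proof.
  intros Hi.
  assert (Q0 : 0 < IZR Q) by (apply IZR_lt; assumption).
  pose proof (frac_part_bounds (z * IZR Q)) as F; unfold frac_part in F.
  set (m0 := Int_part (z * IZR Q)) in *.
  set (f := z * IZR Q - IZR m0) in *.
  unfold centre, error.
  set (M := (N * i + m0)%Z).
  pose proof (Z.mod_pos_bound M Q level_pos) as Bm.
  (* The drift accumulated after [i] steps, in units of the grid width [/ Q]: at most
     [i / Q <= 1]. *)
  set (e := IZR i * (IZR Q * r - IZR N)).
  assert (He : - 1 <= e <= 1).
  { apply Rabs_le_bounds; unfold e; rewrite Rabs_mult.
    rewrite Rabs_right by (apply Rle_ge, IZR_le; lia).
    assert (Hi1 : 0 <= IZR i <= IZR Q) by (split; apply IZR_le; lia).
    apply Rle_trans with (IZR Q * / IZR Q); [|right; field; lra].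
    apply Rmult_le_compat; try lra; apply Rabs_pos. }
  assert (E : z + IZR i * r = (IZR (M mod Q) + (f + e)) / IZR Q + IZR (M / Q)).
  { assert (HM : IZR (M mod Q) = IZR N * IZR i + IZR m0 - IZR Q * IZR (M / Q)).
    { pose proof (Z.div_mod M Q ltac:(lia)) as D.
      rewrite <- !mult_IZR, <- plus_IZR, <- minus_IZR; f_equal.
      unfold M in *; lia. }
    rewrite HM; unfold f, e; field; lra. }
  rewrite E, psi_shift.
  set (m := (M mod Q)%Z) in *.
  set (t := (IZR m + (f + e)) / IZR Q).
  assert (T2 : -1 / IZR Q <= t - IZR m / IZR Q <= 2 / IZR Q).
  { unfold t; replace ((IZR m + (f + e)) / IZR Q - IZR m / IZR Q)
      with ((f + e) * / IZR Q) by (field; lra).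
    unfold Rdiv; split; apply Rmult_le_compat_r; try lra;
      left; apply Rinv_0_lt_compat; assumption. }
  assert (I0 : 0 < / IZR Q) by (apply Rinv_0_lt_compat; assumption).
  assert (Bm' : 0 <= IZR m / IZR Q < 1).
  { assert (0 <= IZR m) by (apply IZR_le; lia).
    assert (IZR m < IZR Q) by (apply IZR_lt; lia).
    split; [apply Rmult_le_pos; lra|].
    apply Rmult_lt_reg_r with (IZR Q); [assumption|].
    unfold Rdiv; rewrite Rmult_assoc, Rinv_l; lra. }
  unfold psi; pose proof (frac_part_bounds t) as Ft.
  (* At the residues 0 and [Q - 1] the trivial bound 1 is used. Elsewhere [1 <= m <= Q - 2] absorbs
     [-1 <= f + e < 2], so the fractional part does not wrap around. *)
  destruct (Z.eqb_spec m 0); [apply Rabs_le; destruct (m =? Q - 1)%Z; lra|].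
  destruct (Z.eqb_spec m (Q - 1)); [apply Rabs_le; lra|].
  assert (H1 : 1 <= IZR m) by (apply IZR_le; lia).
  assert (H2 : IZR m <= IZR Q - 2) by (rewrite <- minus_IZR; apply IZR_le; lia).
  rewrite (frac_part_unique t 0).
  - apply Rabs_le; lra.
  - unfold t; rewrite Rminus_0_r; split.
    + apply Rmult_le_pos; lra.
    + apply Rmult_lt_reg_r with (IZR Q); [assumption|].
      unfold Rdiv; rewrite Rmult_assoc, Rinv_l; lra.
Qed.

(** Since [m] runs through all residues, the centres add up to exactly [- / 2] and the errors to at
    most [2 + 1 + 1]. *)
Lemma psi_sum_block (z : R) : Rabs (psi_sum r z (Z.to_nat Q)) <= 5.
Proof.
  assert (Q1 : 1 <= IZR Q) by (apply IZR_le; lia).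
  assert (I0 : 0 < / IZR Q) by (apply Rinv_0_lt_compat; lra).
  set (m0 := Int_part (z * IZR Q)).
  assert (EQ : INR (Z.to_nat Q) = IZR Q).
  { rewrite INR_IZR_INZ, Z2Nat.id; [reflexivity|lia]. }
  assert (P1 : forall m, centre (m mod Q) = centre m).
  { intros m; unfold centre; rewrite Zmod_mod; reflexivity. }
  assert (P2 : forall m, error (m mod Q) = error m).
  { intros m; unfold error; rewrite Zmod_mod; reflexivity. }
  assert (SC : sumN (fun i => centre (N * Z.of_nat i + m0)) (Z.to_nat Q) = - / 2).
  { rewrite (sumN_reindex Q N m0 level_pos coprime_N centre P1).
    rewrite (sumN_ext _ (fun i => / IZR Q * IZR (Z.of_nat i) + - / 2)).
    - rewrite sumN_plus, sumN_scal, sumN_const.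
      pose proof (sumN_id (Z.to_nat Q)) as S.
      replace (sumN (fun i => IZR (Z.of_nat i)) (Z.to_nat Q))
        with (IZR Q * (IZR Q - 1) / 2) by (rewrite EQ in S; lra).
      rewrite EQ; field; lra.
    - intros i Hi; unfold centre; rewrite Z.mod_small by lia; unfold Rdiv; ring. }
  assert (SE : sumN (fun i => error (N * Z.of_nat i + m0)) (Z.to_nat Q) <= 4).
  { rewrite (sumN_reindex Q N m0 level_pos coprime_N error P2).
    rewrite (sumN_ext _ (fun i => 2 / IZR Q + ((if (Z.of_nat i =? 0)%Z then 1 else 0)
      + (if (Z.of_nat i =? Q - 1)%Z then 1 else 0)))).
    - rewrite sumN_plus, sumN_plus, sumN_const, EQ.
      pose proof (sumN_indicator 0 (Z.to_nat Q)).
      pose proof (sumN_indicator (Q - 1) (Z.to_nat Q)).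
      replace (IZR Q * (2 / IZR Q)) with 2 by (field; lra). lra.
    - intros i Hi; unfold error; rewrite !Z.mod_small by lia; reflexivity. }
  pose proof (sumN_Rabs (fun i => psi (z + INR i * r) - centre (N * Z.of_nat i + m0))
    (Z.to_nat Q)) as T.
  assert (T2 : sumN (fun i => Rabs (psi (z + INR i * r) - centre (N * Z.of_nat i + m0)))
    (Z.to_nat Q) <= 4).
  { eapply Rle_trans; [|exact SE]; apply sumN_le; intros i Hi.
    rewrite INR_IZR_INZ; apply psi_near_centre; lia. }
  assert (D : psi_sum r z (Z.to_nat Q)
     = sumN (fun i => psi (z + INR i * r) - centre (N * Z.of_nat i + m0)) (Z.to_nat Q)
       + sumN (fun i => centre (N * Z.of_nat i + m0)) (Z.to_nat Q)).
  { rewrite <- sumN_plus; apply sumN_ext; intros; ring. }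
  rewrite D, SC.
  eapply Rle_trans; [apply Rabs_triang|].
  rewrite Rabs_Ropp, (Rabs_right (/ 2)); lra.
Qed.

End Block.

Lemma psi_sum_multiple (r C : R) (Q : nat) :
  (forall z, Rabs (psi_sum r z Q) <= C) ->
  forall (c : nat) z, Rabs (psi_sum r z (c * Q)) <= INR c * C.
Proof.
  intros H c; induction c as [|c IH]; intros z.
  - simpl; unfold psi_sum; simpl; rewrite Rabs_R0; lra.
  - change (S c * Q)%nat with (Q + c * Q)%nat; rewrite psi_sum_add, S_INR.
    eapply Rle_trans; [apply Rabs_triang|].
    specialize (H z); specialize (IH (z + INR Q * r)); lra.
Qed.

(** Full blocks come first and cost [C] each; the remaining sum starts further along the orbit, at
    [z']. *)
Lemma psi_sum_euclid (r C : R) (Q n : nat) : (0 < Q)%nat ->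
  (forall z, Rabs (psi_sum r z Q) <= C) ->
  forall z, exists z', Rabs (psi_sum r z n)
    <= INR (n / Q) * C + Rabs (psi_sum r z' (n mod Q)).
Proof.
  intros Q0 H z; exists (z + INR (n / Q * Q) * r).
  rewrite (Nat.div_mod_eq n Q) at 1.
  rewrite (Nat.mul_comm Q), psi_sum_add.
  eapply Rle_trans; [apply Rabs_triang|].
  apply Rplus_le_compat_r, psi_sum_multiple; assumption.
Qed.

(** * Weighted discrepancy sums *)

Lemma ln_le_sub_1 (x : R) : 0 < x -> ln x <= x - 1.
Proof.
  intros H; destruct (Req_dec x 1) as [->|N]; [rewrite ln_1; lra|].
  rewrite <- (exp_ln x H) at 2. pose proof (exp_ineq1_le (ln x)); lra.
Qed.

Lemma ln_le (x y : R) : 0 < x -> x <= y -> ln x <= ln y.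
Proof.
  intros Hx [H| ->]; [left; apply ln_increasing; assumption|right; reflexivity].
Qed.

(** Each term satisfies [1 / (n + 1) <= ln (n + 1) - ln n], from [ln x <= x - 1] at
    [x = n / (n + 1)]. *)
Lemma harmonic_le_ln (a d : nat) : (0 < a)%nat ->
  sumN (fun i => / INR (a + i + 1)) d <= ln (INR (a + d)) - ln (INR a).
Proof.
  intros Ha; induction d as [|d IH]; [rewrite Nat.add_0_r; simpl; lra|].
  cbn [sumN].
  assert (P1 : 0 < INR (a + d)) by (apply lt_0_INR; lia).
  assert (P2 : 0 < INR (a + d + 1)) by (apply lt_0_INR; lia).
  replace (a + S d)%nat with (a + d + 1)%nat by lia.
  pose proof (ln_le_sub_1 (INR (a + d) / INR (a + d + 1))
    (Rdiv_lt_0_compat _ _ P1 P2)) as L.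
  unfold Rdiv in L; rewrite ln_mult, ln_Rinv in L;
    [|assumption|assumption|apply Rinv_0_lt_compat; assumption].
  assert (E : INR (a + d) * / INR (a + d + 1) = 1 - / INR (a + d + 1)).
  { rewrite (plus_INR (a + d) 1) in *; simpl (INR 1) in *; field; lra. }
  lra.
Qed.

Lemma telescope_inv (a d : nat) : (0 < a)%nat ->
  sumN (fun i => / INR (a + i) - / INR (a + i + 1)) d = / INR a - / INR (a + d).
Proof.
  intros Ha; induction d as [|d IH]; [rewrite Nat.add_0_r; simpl; lra|].
  cbn [sumN]; rewrite IH.
  replace (a + S d)%nat with (a + d + 1)%nat by lia. ring.
Qed.

Section WeightedDiscrepancy.

Variables (r : R) (b Q : nat -> nat) (k : nat).
Hypothesis Q0 : Q 0%nat = 1%nat.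
Hypothesis b_pos : forall j, (j < k)%nat -> (1 <= b j)%nat.
Hypothesis Q_lower : forall j, (j < k)%nat -> (b j * Q j <= Q (S j))%nat.
Hypothesis Q_upper : forall j, (j < k)%nat -> (Q (S j) <= (b j + 1) * Q j)%nat.
Hypothesis block : forall j, (j < k)%nat -> forall z, Rabs (psi_sum r z (Q j)) <= 5.

Let level_bound (j : nat) : R := 5 * sumN (fun i => INR (b i)) j.

Lemma level_pos j : (j <= k)%nat -> (1 <= Q j)%nat.
Proof.
  induction j as [|j IH]; intros H; [lia|].
  specialize (IH ltac:(lia)); pose proof (Q_lower j ltac:(lia)); pose proof (b_pos j ltac:(lia)).
  nia.
Qed.

(** An Ostrowski expansion of [n]: dividing by [Q j] leaves at most [b j] blocks of cost 5 and a
    remainder below [Q j], treated at the lower level. *)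
Lemma psi_sum_le_level_bound j : (j <= k)%nat ->
  forall n z, (n < Q j)%nat -> Rabs (psi_sum r z n) <= level_bound j.
Proof.
  induction j as [|j IH]; intros Hj n z Hn.
  - rewrite Q0 in Hn; replace n with O by lia.
    unfold psi_sum, level_bound; simpl; rewrite Rabs_R0; lra.
  - pose proof (level_pos j ltac:(lia)) as P.
    destruct (psi_sum_euclid r 5 (Q j) n ltac:(lia) (block j ltac:(lia)) z) as [z' E].
    pose proof (IH ltac:(lia) (n mod Q j)%nat z' (Nat.mod_upper_bound n (Q j) ltac:(lia))) as I.
    pose proof (Q_upper j ltac:(lia)) as U.
    assert (D : (n / Q j <= b j)%nat).
    { assert ((n / Q j < b j + 1)%nat); [|lia].
      apply Nat.Div0.div_lt_upper_bound; lia. }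
    apply le_INR in D. unfold level_bound in *; cbn [sumN]. lra.
Qed.

(** Only the first division is made here and its quotient is kept as [n / Q j], which beats
    [level_bound (S j)] when [n] is small compared with [Q (S j)]. *)
Lemma psi_sum_le_linear j : (j < k)%nat ->
  forall n z, Rabs (psi_sum r z n) <= 5 * (INR n / INR (Q j)) + level_bound j.
Proof.
  intros Hj n z; pose proof (level_pos j ltac:(lia)) as P.
  destruct (psi_sum_euclid r 5 (Q j) n ltac:(lia) (block j ltac:(lia)) z) as [z' E].
  pose proof (psi_sum_le_level_bound j ltac:(lia) (n mod Q j)%nat z'
    (Nat.mod_upper_bound n (Q j) ltac:(lia))) as I.
  assert (P' : 0 < INR (Q j)) by (apply lt_0_INR; lia).
  assert (D : INR (n / Q j) <= INR n / INR (Q j)).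
  { apply Rmult_le_reg_r with (INR (Q j)); [assumption|].
    unfold Rdiv; rewrite Rmult_assoc, Rinv_l, Rmult_1_r, <- mult_INR by lra.
    apply le_INR; rewrite Nat.mul_comm; apply Nat.Div0.mul_div_le. }
  lra.
Qed.

Variable A : nat -> R.
(** The starting point may depend on [n], which admits sums taken backwards along the orbit. *)
Hypothesis A_psi_sum : forall n, exists z, Rabs (A n) = Rabs (psi_sum r z n).

(** The weight is [1 / (n (n + 1))]. Against it the linear part of the bound leaves a harmonic sum
    of size [ln (Q (S j) / Q j)], and the constant part telescopes. *)
Lemma weighted_step j : (j < k)%nat ->
  sumN (fun i => Rabs (A (Q j + i)) * (/ INR (Q j + i) - / INR (Q j + i + 1)))
    (Q (S j) - Q j)
  <= 5 / INR (Q j) * (1 + ln (INR (b j))) + level_bound j * (/ INR (Q j) - / INR (Q (S j))).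
Proof.
  intros Hj.
  pose proof (level_pos j ltac:(lia)) as P; pose proof (b_pos j Hj) as Pb.
  pose proof (Q_lower j Hj) as L; pose proof (Q_upper j Hj) as U.
  assert (P' : 0 < INR (Q j)) by (apply lt_0_INR; lia).
  apply Rle_trans with (sumN (fun i => 5 / INR (Q j) * / INR (Q j + i + 1)
     + level_bound j * (/ INR (Q j + i) - / INR (Q j + i + 1))) (Q (S j) - Q j)).
  - apply sumN_le; intros i _.
    destruct (A_psi_sum (Q j + i)) as [z ->].
    pose proof (psi_sum_le_linear j Hj (Q j + i) z) as H.
    rewrite (plus_INR (Q j + i) 1); simpl (INR 1).
    set (x := INR (Q j + i)) in *.
    assert (Px : 0 < x) by (apply lt_0_INR; lia).
    replace (5 / INR (Q j) * / (x + 1) + level_bound j * (/ x - / (x + 1)))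
      with ((5 * (x / INR (Q j)) + level_bound j) * (/ x - / (x + 1))) by (field; lra).
    apply Rmult_le_compat_r; [|assumption].
    assert (/ (x + 1) <= / x) by (apply Rinv_le_contravar; lra). lra.
  - rewrite sumN_plus, !sumN_scal, telescope_inv by lia.
    replace (Q j + (Q (S j) - Q j))%nat with (Q (S j)) by nia.
    apply Rplus_le_compat_r, Rmult_le_compat_l.
    + apply Rmult_le_pos; [lra|left; apply Rinv_0_lt_compat; assumption].
    + eapply Rle_trans; [apply harmonic_le_ln; lia|].
      replace (Q j + (Q (S j) - Q j))%nat with (Q (S j)) by nia.
      assert (Pb' : 1 <= INR (b j)) by (apply (le_INR 1); assumption).
      (* [b + 1 <= 2 b <= e b]; the factor [exp 1] becomes the summand 1 after taking logarithms. *)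
      assert (E1 : INR (Q (S j)) <= (exp 1 * INR (b j)) * INR (Q j)).
      { apply le_INR in U; rewrite mult_INR, plus_INR in U; simpl (INR 1) in U.
        eapply Rle_trans; [exact U|]; apply Rmult_le_compat_r; [lra|].
        pose proof (exp_ineq1_le 1); nra. }
      assert (PS : 0 < INR (Q (S j))) by (apply lt_0_INR; nia).
      apply ln_le in E1; [|assumption].
      pose proof (exp_pos 1).
      rewrite !ln_mult, ln_exp in E1; try lra; nra.
Qed.

(* The term [level_bound J / Q J] is the potential that makes the induction telescope:
   it absorbs the contribution of the bound reached at level [J] to all later levels. *)
Lemma weighted_discrepancy_levels J : (J <= k)%nat ->
  sumN (fun i => Rabs (A (1 + i)) * (/ INR (1 + i) - / INR (1 + i + 1))) (Q J - 1)
    + level_bound J * / INR (Q J)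
  <= 5 * sumN (fun j => (2 + ln (INR (b j))) / INR (Q j)) J.
Proof.
  induction J as [|J IH]; intros HJ.
  - rewrite Q0; unfold level_bound; simpl; lra.
  - specialize (IH ltac:(lia)).
    pose proof (level_pos J ltac:(lia)) as P; pose proof (level_pos (S J) ltac:(lia)) as PS.
    pose proof (Q_lower J ltac:(lia)) as L; pose proof (b_pos J ltac:(lia)) as Pb.
    replace (Q (S J) - 1)%nat with ((Q J - 1) + (Q (S J) - Q J))%nat by nia.
    rewrite sumN_add.
    pose proof (weighted_step J ltac:(lia)) as W.
    rewrite (sumN_ext (fun i => Rabs (A (1 + (Q J - 1 + i))) * _)
      (fun i => Rabs (A (Q J + i)) * (/ INR (Q J + i) - / INR (Q J + i + 1)))).
    2: { intros i _; replace (1 + (Q J - 1 + i))%nat with (Q J + i)%nat by lia; reflexivity. }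
    assert (P' : 0 < INR (Q J)) by (apply lt_0_INR; lia).
    assert (PS' : 0 < INR (Q (S J))) by (apply lt_0_INR; lia).
    (* The increment [5 b_J / Q_(J+1)] of the potential is at most [5 / Q_J], which turns [1 + ln]
       into [2 + ln]. *)
    assert (E : INR (b J) * / INR (Q (S J)) <= / INR (Q J)).
    { apply le_INR in L; rewrite mult_INR in L.
      apply Rmult_le_reg_r with (INR (Q (S J)) * INR (Q J)); [nra|].
      replace (INR (b J) * / INR (Q (S J)) * (INR (Q (S J)) * INR (Q J)))
        with (INR (b J) * INR (Q J)) by (field; lra).
      replace (/ INR (Q J) * (INR (Q (S J)) * INR (Q J))) with (INR (Q (S J)))
        by (field; lra). assumption. }
    cbn [sumN].
    assert (EB : level_bound (S J) * / INR (Q (S J))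
       = level_bound J * / INR (Q (S J)) + 5 * (INR (b J) * / INR (Q (S J)))).
    { unfold level_bound; cbn [sumN]; ring. }
    rewrite EB.
    replace ((2 + ln (INR (b J))) / INR (Q J))
      with (/ INR (Q J) + / INR (Q J) * (1 + ln (INR (b J)))) by (field; lra).
    unfold Rdiv in W. lra.
Qed.

Lemma weighted_discrepancy (H : nat) : (H < Q k)%nat ->
  sumN (fun i => Rabs (A (1 + i)) * (/ INR (1 + i) - / INR (1 + i + 1))) H
  <= 5 * sumN (fun j => (2 + ln (INR (b j))) / INR (Q j)) k.
Proof.
  intros HH; eapply Rle_trans; [|apply weighted_discrepancy_levels; lia].
  assert (0 <= level_bound k * / INR (Q k)).
  { apply Rmult_le_pos.
    - unfold level_bound; apply Rmult_le_pos; [lra|]; apply sumN_ge0; intros; apply pos_INR.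
    - left; apply Rinv_0_lt_compat, lt_0_INR; lia. }
  eapply Rle_trans; [apply (sumN_le_len _ H (Q k - 1)); [|lia]|lra].
  intros i; apply Rmult_le_pos; [apply Rabs_pos|].
  assert (/ INR (1 + i + 1) <= / INR (1 + i)); [|lra].
  apply Rinv_le_contravar; [apply lt_0_INR; lia|apply le_INR; lia].
Qed.

End WeightedDiscrepancy.

(** * Perturbing half of a sine product *)

Lemma exp_le (x y : R) : x <= y -> exp x <= exp y.
Proof.
  intros [H| ->]; [left; apply exp_increasing; assumption|right; reflexivity].
Qed.

Lemma sumN_inv_squares_le (n : nat) : sumN (fun i => / (INR (1 + i)) ^ 2) n <= 2.
Proof.
  (* The sharper bound is inductive, because [1 / (n + 1)^2 <= 1 / n - 1 / (n + 1)]. *)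
  assert (H : forall m, sumN (fun i => / (INR (1 + i)) ^ 2) (S m) <= 2 - / (INR m + 1)).
  { intros m; induction m as [|m IH]; [simpl; lra|].
    change (sumN (fun i => / (INR (1 + i)) ^ 2) (S m) + / (INR (1 + S m)) ^ 2
      <= 2 - / (INR (S m) + 1)).
    replace (INR (1 + S m)) with (1 + (INR m + 1)) by (change (1 + S m)%nat with (S (S m)); rewrite !S_INR; ring).
    rewrite S_INR.
    pose proof (pos_INR m) as P; set (x := INR m) in *.
    assert (/ (1 + (x + 1)) ^ 2 <= / (x + 1) - / (x + 1 + 1)); [|lra].
    apply Rmult_le_reg_r with ((x + 1) * (x + 2) ^ 2); [nra|].
    replace (/ (1 + (x + 1)) ^ 2 * ((x + 1) * (x + 2) ^ 2)) with (x + 1)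
      by (field; lra).
    replace ((/ (x + 1) - / (x + 1 + 1)) * ((x + 1) * (x + 2) ^ 2)) with (x + 2)
      by (field; lra). lra. }
  destruct n as [|m]; [simpl; lra|].
  specialize (H m).
  assert (0 < / (INR m + 1)) by (apply Rinv_0_lt_compat; pose proof (pos_INR m); lra).
  lra.
Qed.

(** In the Taylor lower bound of degree 7 the last two terms combine to
    [a^5 (42 - a^2) / 5040 >= 0]. *)
Lemma sin_ge_cubic (a : R) : 0 <= a -> a <= 4 -> a <= PI -> a - a ^ 3 / 6 <= sin a.
Proof.
  intros H0 H4 HP; pose proof (SIN a H0 HP) as [L _].
  unfold sin_lb, sin_approx, sin_term in L; simpl in L.
  assert (E : a * a <= 16) by nra.
  assert (F : 0 <= a ^ 5 * (42 - a * a)) by (apply Rmult_le_pos; [apply pow_le|]; lra).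
  simpl in F |- *. lra.
Qed.

(** Up to [PI / 2 <= 2] a Taylor bound gives slope [3 / 8]. Beyond, reflect:
    [PI - a >= PI / 4 >= a / 3], which costs a factor 3. *)
Lemma sin_ge_linear (a : R) : 0 <= a <= 3 * PI / 4 -> a / 8 <= sin a.
Proof.
  assert (P0 := PI_RGT_0); assert (P4 := PI_4).
  assert (H : forall t, 0 <= t <= 2 -> t <= PI -> 3 * t / 8 <= sin t).
  { intros t Ht HP; pose proof (SIN t (proj1 Ht) HP) as [L _].
    unfold sin_lb, sin_approx, sin_term in L; simpl in L.
    set (u := t * t) in *.
    assert (Hu : 0 <= u <= 4) by (unfold u; nra).
    assert (F : 0 <= 1 - u / 6 + u * u / 120 - u * u * u / 5040 - 3 / 8).
    { assert (0 <= (4 - u) * (u * u)) by (apply Rmult_le_pos; nra). nra. }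
    assert (G : 0 <= t * (1 - u / 6 + u * u / 120 - u * u * u / 5040 - 3 / 8))
      by (apply Rmult_le_pos; lra).
    unfold u in G; lra. }
  intros Ha; destruct (Rle_dec a (PI / 2)) as [C|C].
  - specialize (H a); lra.
  - rewrite <- (Rtrigo_facts.sin_pi_minus a).
    specialize (H (PI - a)); lra.
Qed.

Lemma Rabs_sin_le (x : R) : Rabs (sin x) <= Rabs x.
Proof.
  assert (H : forall t, 0 <= t -> Rabs (sin t) <= t).
  { intros t [Ht| <-]; [|rewrite sin_0, Rabs_R0; lra].
    destruct (Rle_dec t 1) as [L|L].
    - rewrite Rabs_right; [left; apply sin_lt_x; assumption|].
      pose proof PI2_3_2. apply Rle_ge, sin_ge_0; lra.
    - pose proof (SIN_bound t); apply Rabs_le; lra. }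
  destruct (Rle_dec 0 x).
  - rewrite (Rabs_right x); [apply H|]; lra.
  - rewrite (Rabs_left x), <- (Rabs_Ropp (sin x)), <- sin_neg; [apply H|]; lra.
Qed.

Lemma Rabs_sin_sub_le (x y : R) : Rabs (sin x - sin y) <= Rabs (x - y).
Proof.
  rewrite form4, !Rabs_mult, (Rabs_right 2) by lra.
  pose proof (Rabs_sin_le ((x - y) / 2)) as S.
  assert (C : Rabs (cos ((x + y) / 2)) <= 1)
    by (pose proof (COS_bound ((x + y) / 2)); apply Rabs_le; lra).
  replace (Rabs (x - y)) with (2 * Rabs ((x - y) / 2)).
  - pose proof (Rabs_pos (sin ((x - y) / 2))).
    pose proof (Rabs_pos (cos ((x + y) / 2))). nra.
  - rewrite <- (Rabs_right 2) at 1 by lra. rewrite <- Rabs_mult; f_equal; field.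
Qed.

Lemma one_minus_cos_le (x : R) : 0 <= 1 - cos x <= x ^ 2 / 2.
Proof.
  replace (cos x) with (1 - 2 * sin (x / 2) * sin (x / 2)).
  - pose proof (Rsqr_le_abs_1 _ _ (Rabs_sin_le (x / 2))) as H; unfold Rsqr in H.
    simpl; nra.
  - rewrite <- cos_2a_sin; f_equal; field.
Qed.

Lemma Rabs_sin_sub_id_le (x : R) : Rabs x <= 1 -> Rabs (sin x - x) <= Rabs x ^ 3 / 6.
Proof.
  pose proof PI2_3_2.
  assert (H' : forall t, 0 <= t <= 1 -> Rabs (sin t - t) <= t ^ 3 / 6).
  { intros t Ht. pose proof (sin_ge_cubic t ltac:(lra) ltac:(lra) ltac:(lra)).
    pose proof (Rabs_sin_le t) as L; rewrite (Rabs_right t) in L by lra.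
    apply Rabs_le_bounds in L.
    assert (0 <= t ^ 3) by (apply pow_le; lra). apply Rabs_le; lra. }
  intros Hx; apply Rabs_le_bounds in Hx; destruct (Rle_dec 0 x).
  - rewrite (Rabs_right x) by lra; apply H'; lra.
  - rewrite (Rabs_left x) by lra; rewrite <- Rabs_Ropp.
    replace (- (sin x - x)) with (sin (- x) - - x) by (rewrite sin_neg; ring).
    apply H'; lra.
Qed.

(** With [s = t - 2 t^2], [exp (- s) >= 1 - s] and [(1 + t) (1 - s) = 1 + t^2 (1 + 2 t) >= 1]. *)
Lemma exp_le_1_plus (t : R) : - / 2 <= t -> exp (t - 2 * t ^ 2) <= 1 + t.
Proof.
  intros H.
  assert (P : 0 < exp (t - 2 * t ^ 2)) by apply exp_pos.
  assert (I : 1 - (t - 2 * t ^ 2) <= / exp (t - 2 * t ^ 2)).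
  { rewrite <- exp_Ropp; pose proof (exp_ineq1_le (- (t - 2 * t ^ 2))); lra. }
  assert (G : 1 <= (1 + t) * (1 - (t - 2 * t ^ 2))) by (simpl; nra).
  apply Rmult_le_reg_r with (/ exp (t - 2 * t ^ 2)); [apply Rinv_0_lt_compat; assumption|].
  rewrite Rinv_r by lra. nra.
Qed.

Lemma prodN_exp_bounds (t : nat -> R) (n : nat) :
  (forall i, (i < n)%nat -> - / 2 <= t i) ->
  exp (sumN t n - 2 * sumN (fun i => t i ^ 2) n) <= prodN (fun i => 1 + t i) n
    <= exp (sumN t n).
Proof.
  induction n as [|n IH]; intros H; [simpl; rewrite Rmult_0_r, Rminus_0_r, exp_0; lra|].
  specialize (IH ltac:(auto)); specialize (H n ltac:(lia)); cbn [sumN prodN].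
  pose proof (exp_le_1_plus (t n) H) as L; pose proof (exp_ineq1_le (t n)) as U.
  replace (sumN t n + t n - 2 * (sumN (fun i => t i ^ 2) n + t n ^ 2))
    with ((sumN t n - 2 * sumN (fun i => t i ^ 2) n) + (t n - 2 * t n ^ 2)) by ring.
  rewrite !exp_plus.
  pose proof (exp_pos (sumN t n - 2 * sumN (fun i => t i ^ 2) n)).
  pose proof (exp_pos (t n - 2 * t n ^ 2)).
  split; apply Rmult_le_compat; lra.
Qed.

Section HalfProduct.

Variables (q H : nat) (w eta L : R) (f : nat -> R).
Hypothesis q_ge_2 : (2 <= q)%nat.
Hypothesis H_le : (2 * H <= q)%nat.
Hypothesis w_le : Rabs w <= / 2.
Hypothesis eta_small : 0 <= eta <= / 20.
Hypothesis f_le : forall i, Rabs (f i) <= / 2.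
Hypothesis f_discrepancy :
  sumN (fun i => Rabs (sumN f (1 + i)) * (/ INR (1 + i) - / INR (1 + i + 1))) H <= L.

(* Factors are numbered from 0, so index [i] stands for the node [n = i + 1].  By
   [t], the perturbed factor is [sin (v i + g i) = sin (v i) * (1 + t i)]. *)
Let v (i : nat) : R := PI * (INR (1 + i) + w) / INR q.
Let g (i : nat) : R := PI * (eta * f i) / INR q.
Let cot (i : nat) : R := cos (v i) / sin (v i).
Let t (i : nat) : R := cos (g i) - 1 + cot i * sin (g i).

Lemma INR_q_ge_2 : 2 <= INR q.
Proof. apply (le_INR 2); assumption. Qed.

Lemma index_ge_1 i : 1 <= INR (1 + i).
Proof. apply (le_INR 1); lia. Qed.

Lemma index_le_half i : (i < H)%nat -> 2 * INR (1 + i) <= INR q.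
Proof. intros Hi; change 2 with (INR 2); rewrite <- mult_INR; apply le_INR; lia. Qed.

Lemma v_lower i : PI * INR (1 + i) / (2 * INR q) <= v i.
Proof.
  pose proof INR_q_ge_2; pose proof (index_ge_1 i); pose proof PI_RGT_0.
  apply Rabs_le_bounds in w_le; unfold v.
  apply Rmult_le_reg_r with (2 * INR q); [lra|].
  replace (PI * INR (1 + i) / (2 * INR q) * (2 * INR q)) with (PI * INR (1 + i)) by (field; lra).
  replace (PI * (INR (1 + i) + w) / INR q * (2 * INR q)) with (PI * (2 * (INR (1 + i) + w)))
    by (field; lra).
  apply Rmult_le_compat_l; lra.
Qed.

(** [n <= q / 2] and [w <= / 2 <= q / 4]. Staying away from [PI] is the reason for treating half of
    the nodes at a time. *)
Lemma v_upper i : (i < H)%nat -> v i <= 3 * PI / 4.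
Proof.
  intros Hi; pose proof INR_q_ge_2; pose proof (index_le_half i Hi); pose proof PI_RGT_0.
  apply Rabs_le_bounds in w_le; unfold v.
  apply Rmult_le_reg_r with (INR q); [lra|].
  replace (PI * (INR (1 + i) + w) / INR q * INR q) with (PI * (INR (1 + i) + w))
    by (field; lra).
  replace (3 * PI / 4 * INR q) with (PI * (3 * INR q / 4)) by field.
  apply Rmult_le_compat_l; lra.
Qed.

Lemma v_pos i : 0 < v i.
Proof.
  eapply Rlt_le_trans; [|apply v_lower].
  pose proof INR_q_ge_2; pose proof (index_ge_1 i); pose proof PI_RGT_0.
  apply Rdiv_lt_0_compat; nra.
Qed.

Lemma sin_v_lower i : (i < H)%nat -> PI * INR (1 + i) / (16 * INR q) <= sin (v i).
Proof.
  intros Hi; pose proof (v_lower i); pose proof (v_pos i); pose proof (v_upper i Hi).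
  pose proof (sin_ge_linear (v i) ltac:(lra)).
  replace (PI * INR (1 + i) / (16 * INR q)) with (PI * INR (1 + i) / (2 * INR q) / 8).
  - lra.
  - field; pose proof INR_q_ge_2; lra.
Qed.

Lemma sin_v_pos i : (i < H)%nat -> 0 < sin (v i).
Proof.
  intros Hi; eapply Rlt_le_trans; [|apply sin_v_lower; assumption].
  pose proof INR_q_ge_2; pose proof (index_ge_1 i); pose proof PI_RGT_0.
  apply Rdiv_lt_0_compat; nra.
Qed.

Lemma cot_le i : (i < H)%nat -> Rabs (cot i) <= 16 * INR q / (PI * INR (1 + i)).
Proof.
  intros Hi; unfold cot, Rdiv at 1; rewrite Rabs_mult, Rabs_inv.
  pose proof (sin_v_pos i Hi); pose proof (sin_v_lower i Hi).
  pose proof INR_q_ge_2; pose proof (index_ge_1 i); pose proof PI_RGT_0.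
  rewrite (Rabs_right (sin (v i))) by lra.
  replace (16 * INR q / (PI * INR (1 + i))) with (1 * / (PI * INR (1 + i) / (16 * INR q)))
    by (field; lra).
  apply Rmult_le_compat; [apply Rabs_pos|left; apply Rinv_0_lt_compat; assumption| |].
  - pose proof (COS_bound (v i)); apply Rabs_le; lra.
  - apply Rinv_le_contravar; [apply Rdiv_lt_0_compat; nra|assumption].
Qed.

Lemma g_le i : Rabs (g i) <= PI * eta / (2 * INR q).
Proof.
  pose proof INR_q_ge_2; pose proof PI_RGT_0.
  unfold g, Rdiv; rewrite !Rabs_mult, Rabs_inv, (Rabs_right PI), (Rabs_right eta),
    (Rabs_right (INR q)) by lra.
  replace (PI * eta * / (2 * INR q)) with (PI * (eta * / 2) * / INR q) by (field; lra).
  apply Rmult_le_compat_r; [left; apply Rinv_0_lt_compat; lra|].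
  apply Rmult_le_compat_l; [lra|]. apply Rmult_le_compat_l; [lra|apply f_le].
Qed.

Lemma g_le_inv i : (i < H)%nat -> Rabs (g i) <= eta / INR (1 + i).
Proof.
  intros Hi; eapply Rle_trans; [apply g_le|].
  pose proof INR_q_ge_2; pose proof (index_ge_1 i); pose proof (index_le_half i Hi); pose proof PI_4.
  pose proof PI_RGT_0.
  apply Rmult_le_reg_r with (2 * INR q * INR (1 + i)); [nra|].
  replace (PI * eta / (2 * INR q) * (2 * INR q * INR (1 + i)))
    with (eta * (PI * INR (1 + i))) by (field; lra).
  replace (eta / INR (1 + i) * (2 * INR q * INR (1 + i)))
    with (eta * (2 * INR q)) by (field; lra).
  apply Rmult_le_compat_l; [lra|nra].
Qed.

Lemma g_cot_le i : (i < H)%nat -> Rabs (g i) * Rabs (cot i) <= 8 * eta / INR (1 + i).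
Proof.
  intros Hi; pose proof INR_q_ge_2; pose proof (index_ge_1 i); pose proof PI_RGT_0.
  replace (8 * eta / INR (1 + i))
    with (PI * eta / (2 * INR q) * (16 * INR q / (PI * INR (1 + i)))) by (field; lra).
  apply Rmult_le_compat; try apply Rabs_pos; [apply g_le|apply cot_le; assumption].
Qed.

Lemma t_le i : (i < H)%nat -> Rabs (t i) <= 9 * eta / INR (1 + i).
Proof.
  intros Hi; pose proof (index_ge_1 i).
  pose proof (g_cot_le i Hi) as GC; pose proof (g_le_inv i Hi) as G.
  pose proof (one_minus_cos_le (g i)) as C; pose proof (Rabs_sin_le (g i)) as S.
  assert (C2 : Rabs (cot i * sin (g i)) <= 8 * eta / INR (1 + i)).
  { rewrite Rabs_mult; pose proof (Rabs_pos (cot i)); nra. }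
  rewrite <- (pow2_abs (g i)) in C.
  assert (E : eta / INR (1 + i) <= 1).
  { apply Rmult_le_reg_r with (INR (1 + i)); [lra|].
    unfold Rdiv; rewrite Rmult_assoc, Rinv_l; lra. }
  pose proof (Rabs_pos (g i)).
  unfold t; eapply Rle_trans; [apply Rabs_triang|].
  replace (cos (g i) - 1) with (- (1 - cos (g i))) by ring.
  rewrite Rabs_Ropp, (Rabs_right (1 - cos (g i))) by lra.
  unfold Rdiv in *; nra.
Qed.

(** The remainder consists of [1 - cos g <= g^2 / 2] and of [cot v (sin g - g)], bounded by
    [|g cot v| g^2 / 6]. Both are [O (eta^2 / n^2)], and one factor [eta] absorbs the constants. *)
Lemma t_first_order i : (i < H)%nat ->
  Rabs (t i - g i * cot i) <= eta * / INR (1 + i) ^ 2.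
Proof.
  intros Hi; pose proof (index_ge_1 i).
  pose proof (g_cot_le i Hi) as GC; pose proof (g_le_inv i Hi) as G.
  pose proof (one_minus_cos_le (g i)) as C.
  set (n := INR (1 + i)) in *.
  assert (I : 0 < / n <= 1).
  { split; [apply Rinv_0_lt_compat; lra|]. rewrite <- Rinv_1; apply Rinv_le_contravar; lra. }
  unfold Rdiv in GC, G.
  assert (G1 : Rabs (g i) <= 1) by nra.
  pose proof (Rabs_sin_sub_id_le (g i) G1) as S.
  pose proof (Rabs_pos (g i)) as G0; pose proof (Rabs_pos (cot i)) as C0.
  rewrite <- (pow2_abs (g i)) in C.
  assert (G2 : Rabs (g i) ^ 2 <= eta ^ 2 * / n ^ 2).
  { rewrite <- pow_inv, <- Rpow_mult_distr; apply pow_incr; lra. }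
  assert (I2 : 0 < / n ^ 2 <= 1) by (rewrite <- pow_inv; simpl; nra).
  replace (t i - g i * cot i)
    with (- (1 - cos (g i)) + cot i * (sin (g i) - g i)) by (unfold t; ring).
  eapply Rle_trans; [apply Rabs_triang|].
  rewrite Rabs_Ropp, (Rabs_right (1 - cos (g i))), Rabs_mult by lra.
  assert (T : Rabs (cot i) * Rabs (sin (g i) - g i) <= 8 * eta * / n * (Rabs (g i) ^ 2 / 6)).
  { apply Rle_trans with (Rabs (cot i) * (Rabs (g i) ^ 3 / 6)).
    - apply Rmult_le_compat_l; assumption.
    - replace (Rabs (cot i) * (Rabs (g i) ^ 3 / 6))
        with (Rabs (g i) * Rabs (cot i) * (Rabs (g i) ^ 2 / 6)) by field.
      apply Rmult_le_compat_r; [|assumption]. pose proof (pow2_ge_0 (Rabs (g i))); lra. }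
  assert (E8 : 0 <= 8 * eta * / n <= / 2) by nra.
  assert (T2 : 8 * eta * / n * (Rabs (g i) ^ 2 / 6) <= / 2 * (eta ^ 2 * / n ^ 2 / 6)).
  { apply Rmult_le_compat; lra. }
  assert (eta ^ 2 * / n ^ 2 <= eta * / n ^ 2); [|lra].
  apply Rmult_le_compat_r; [lra|nra].
Qed.

(** [cot a - cot b = sin (b - a) / (sin a sin b)] with [b - a = PI / q]. The lower bounds on the two
    sines give [16^2 / (n (n + 1))]. *)
Lemma cot_step i : (S i < H)%nat ->
  Rabs (PI / INR q * cot i - PI / INR q * cot (S i))
  <= 256 * (/ INR (1 + i) - / INR (1 + i + 1)).
Proof.
  intros Hi.
  pose proof INR_q_ge_2 as Q2; pose proof (index_ge_1 i) as N1; pose proof PI_RGT_0 as P0.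
  pose proof (sin_v_pos i ltac:(lia)) as S1; pose proof (sin_v_pos (S i) Hi) as S2.
  pose proof (sin_v_lower i ltac:(lia)) as L1; pose proof (sin_v_lower (S i) Hi) as L2.
  assert (En : INR (1 + S i) = INR (1 + i) + 1)
    by (rewrite <- S_INR; f_equal; lia).
  rewrite En in L2; rewrite (plus_INR (1 + i) 1); change (INR 1) with 1.
  set (n := INR (1 + i)) in *.
  assert (E : PI / INR q * cot i - PI / INR q * cot (S i)
    = PI / INR q * (sin (PI / INR q) * / (sin (v i) * sin (v (S i))))).
  { unfold cot. replace (sin (PI / INR q)) with (sin (v (S i) - v i)).
    - rewrite sin_minus; field; lra.
    - f_equal; unfold v; rewrite En; fold n; field; lra. }
  assert (B0 : 0 < PI / INR q) by (apply Rdiv_lt_0_compat; lra).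
  rewrite E, !Rabs_mult, Rabs_inv, Rabs_mult, (Rabs_right (PI / INR q)),
    (Rabs_right (sin (v i))), (Rabs_right (sin (v (S i)))) by lra.
  pose proof (Rabs_sin_le (PI / INR q)) as SB; rewrite (Rabs_right (PI / INR q)) in SB by lra.
  set (D1 := PI * n / (16 * INR q)) in *; set (D2 := PI * (n + 1) / (16 * INR q)) in *.
  assert (D1p : 0 < D1) by (apply Rdiv_lt_0_compat; nra).
  assert (D2p : 0 < D2) by (apply Rdiv_lt_0_compat; nra).
  apply Rle_trans with (PI / INR q * (PI / INR q * / (D1 * D2))).
  - apply Rmult_le_compat_l; [lra|]; apply Rmult_le_compat; try assumption.
    + apply Rabs_pos.
    + left; apply Rinv_0_lt_compat, Rmult_lt_0_compat; assumption.
    + apply Rinv_le_contravar; [apply Rmult_lt_0_compat; assumption|].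
      apply Rmult_le_compat; lra.
  - right; unfold D1, D2; field; lra.
Qed.

(** Abel summation: the increments of the cotangent contribute [256 L], and the boundary term is at
    most [n / 2] times [16 / n], that is 8. *)
Lemma sum_g_cot_le : Rabs (sumN (fun i => g i * cot i) H) <= eta * (256 * L + 8).
Proof.
  assert (E : sumN (fun i => g i * cot i) H
    = eta * sumN (fun i => f i * (PI / INR q * cot i)) H).
  { rewrite <- sumN_scal; apply sumN_ext; intros; unfold g; field.
    pose proof INR_q_ge_2; lra. }
  rewrite E, Rabs_mult, (Rabs_right eta) by lra.
  apply Rmult_le_compat_l; [lra|].
  assert (W : forall i, 0 <= Rabs (sumN f (1 + i)) * (/ INR (1 + i) - / INR (1 + i + 1))).
  { intros i; apply Rmult_le_pos; [apply Rabs_pos|].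
    assert (/ INR (1 + i + 1) <= / INR (1 + i)); [|lra].
    apply Rinv_le_contravar; [apply lt_0_INR; lia|apply le_INR; lia]. }
  pose proof f_discrepancy as FD.
  assert (EH : H = O \/ exists m, H = S m)
    by (destruct (Nat.eq_dec H 0); [left; assumption|right; exists (H - 1)%nat; lia]).
  destruct EH as [EH|[m EH]]; rewrite EH in FD |- *.
  - simpl; rewrite Rabs_R0; simpl in FD; lra.
  - rewrite abel_summation.
    eapply Rle_trans; [apply Rabs_triang|]. apply Rplus_le_compat.
    + eapply Rle_trans; [apply sumN_Rabs|].
      apply Rle_trans with (256 * sumN (fun i => Rabs (sumN f (1 + i))
        * (/ INR (1 + i) - / INR (1 + i + 1))) m).
      * rewrite <- sumN_scal; apply sumN_le; intros i Hi.
        rewrite Rabs_mult.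
        replace (256 * (Rabs (sumN f (1 + i)) * (/ INR (1 + i) - / INR (1 + i + 1))))
          with (Rabs (sumN f (1 + i)) * (256 * (/ INR (1 + i) - / INR (1 + i + 1)))) by ring.
        apply Rmult_le_compat_l; [apply Rabs_pos|]. apply cot_step; lia.
      * apply Rmult_le_compat_l; [lra|]. eapply Rle_trans; [|exact FD].
        apply sumN_le_len; [assumption|lia].
    + pose proof INR_q_ge_2 as Q2; pose proof (index_ge_1 m) as N1; pose proof PI_RGT_0 as P0.
      assert (C : Rabs (PI / INR q * cot m) <= 16 / INR (1 + m)).
      { rewrite Rabs_mult, (Rabs_right (PI / INR q)) by
          (apply Rle_ge; left; apply Rdiv_lt_0_compat; lra).
        replace (16 / INR (1 + m)) with (PI / INR q * (16 * INR q / (PI * INR (1 + m))))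
          by (field; lra).
        apply Rmult_le_compat_l; [left; apply Rdiv_lt_0_compat; lra|apply cot_le; lia]. }
      assert (F : Rabs (sumN f (S m)) <= INR (1 + m) * / 2).
      { eapply Rle_trans; [apply sumN_Rabs|].
        change (1 + m)%nat with (S m); rewrite <- sumN_const.
        apply sumN_le; intros; apply f_le. }
      rewrite Rabs_mult.
      replace 8 with (INR (1 + m) * / 2 * (16 / INR (1 + m))) by (field; lra).
      apply Rmult_le_compat; try apply Rabs_pos; assumption.
Qed.

(** The quotient of the products is [prod (1 + t_i)]. Here [|sum t| <= eta (256 L + 10)] and
    [2 sum t^2 <= 18 eta], so the exponent stays within [256 eta (L + 1)]. *)
Lemma half_product_perturbation :
  let A := prodN (fun i => Rabs (2 * sin (v i))) H in
  let B := prodN (fun i => Rabs (2 * sin (v i + g i))) H in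
  A * exp (- (256 * eta * (L + 1))) <= B <= A * exp (256 * eta * (L + 1)).
Proof.
  intros A B.
  assert (T2 : forall i, (i < H)%nat -> - / 2 <= t i).
  { intros i Hi; pose proof (t_le i Hi) as T; pose proof (index_ge_1 i).
    assert (9 * eta / INR (1 + i) <= / 2).
    { apply Rmult_le_reg_r with (INR (1 + i)); [lra|].
      unfold Rdiv; rewrite Rmult_assoc, Rinv_l; lra. }
    apply Rabs_le_bounds in T; lra. }
  assert (EB : B = A * prodN (fun i => 1 + t i) H).
  { unfold A, B; rewrite <- prodN_mult; apply prodN_ext; intros i Hi.
    specialize (T2 i Hi).
    rewrite <- (Rabs_right (1 + t i)) by lra.
    rewrite <- Rabs_mult; f_equal.
    unfold t, cot; rewrite sin_plus; field.
    pose proof (sin_v_pos i Hi); lra. }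
  rewrite EB.
  assert (A0 : 0 <= A) by (apply prodN_ge0; intros; apply Rabs_pos).
  destruct (prodN_exp_bounds t H T2) as [Lo Up].
  pose proof sum_g_cot_le as SG.
  pose proof (sumN_inv_squares_le H) as SQ.
  assert (S1 : Rabs (sumN t H) <= eta * (256 * L + 10)).
  { rewrite (sumN_ext t (fun i => g i * cot i + (t i - g i * cot i)))
      by (intros; ring).
    rewrite sumN_plus; eapply Rle_trans; [apply Rabs_triang|].
    assert (Rabs (sumN (fun i => t i - g i * cot i) H) <= eta * 2); [|lra].
    eapply Rle_trans; [apply sumN_Rabs|].
    apply Rle_trans with (sumN (fun i => eta * / INR (1 + i) ^ 2) H).
    - apply sumN_le; intros; apply t_first_order; assumption.
    - rewrite sumN_scal; apply Rmult_le_compat_l; lra. }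
  assert (S2 : sumN (fun i => t i ^ 2) H <= 9 * eta).
  { apply Rle_trans with (sumN (fun i => 81 * eta ^ 2 * / INR (1 + i) ^ 2) H).
    - apply sumN_le; intros i Hi; rewrite <- pow2_abs.
      replace (81 * eta ^ 2 * / INR (1 + i) ^ 2) with ((9 * eta / INR (1 + i)) ^ 2)
        by (field; pose proof (index_ge_1 i); lra).
      apply pow_incr; split; [apply Rabs_pos|apply t_le; assumption].
    - rewrite sumN_scal.
      apply Rle_trans with (81 * eta ^ 2 * 2); [apply Rmult_le_compat_l; nra|nra]. }
  apply Rabs_le_bounds in S1.
  split; apply Rmult_le_compat_l; try assumption.
  - eapply Rle_trans; [|exact Lo]. apply exp_le; lra.
  - eapply Rle_trans; [exact Up|]. apply exp_le; lra.
Qed.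

End HalfProduct.

(** * Perturbing a full sine product *)

Lemma psi_sum_shift (r z : R) (n : nat) :
  sumN (fun i => psi (z + INR (1 + i) * r)) n = psi_sum r (z + r) n.
Proof.
  apply sumN_ext; intros i _; f_equal.
  change (1 + i)%nat with (S i); rewrite S_INR; ring.
Qed.

(** The same orbit segment read in the opposite order, starting from its far end. *)
Lemma psi_sum_backward (r z : R) (n : nat) :
  sumN (fun i => psi (z - INR (1 + i) * r)) n = psi_sum r (z - INR n * r) n.
Proof.
  unfold psi_sum; rewrite <- (sumN_rev (fun i => psi (z - INR n * r + INR i * r))).
  apply sumN_ext; intros i Hi; f_equal.
  rewrite !minus_INR by lia; change (1 + i)%nat with (S i); rewrite S_INR.
  simpl (INR 1); ring.
Qed.

Lemma continuity_prodN (F : nat -> R -> R) (n : nat) :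
  (forall i, continuity (F i)) -> continuity (fun y => prodN (fun i => F i y) n).
Proof.
  intros HF; induction n as [|n IH]; simpl.
  - apply continuity_const; intros ? ?; reflexivity.
  - apply (continuity_mult (fun y => prodN (fun i => F i y) n) (F n)); auto.
Qed.

(* For [y <> 0] this is the product formula divided by its first factor; the value
   at [y = 0] follows by continuity. *)
Lemma punctured_sine_product_le (q : nat) (y : R) : (1 <= q)%nat -> Rabs y <= / 2 ->
  prodN (fun i => Rabs (2 * sin (PI * (INR (1 + i) + y) / INR q))) (q - 1) <= 8 * INR q.
Proof.
  intros Hq.
  assert (q1 : 1 <= INR q) by (apply (le_INR 1); assumption).
  pose proof PI_RGT_0 as P0.
  assert (NZ : forall y, y <> 0 -> Rabs y <= / 2 ->
    prodN (fun i => Rabs (2 * sin (PI * (INR (1 + i) + y) / INR q))) (q - 1) <= 8 * INR q).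
  { clear y; intros y Hy0 Hy.
    pose proof (SineProduct.prod_sin q y Hq) as E.
    rewrite prodN_head in E by assumption; simpl (INR 0) in E; rewrite Rplus_0_l in E.
    set (O := prodN _ (q - 1)) in *.
    assert (O0 : 0 <= O) by (apply prodN_ge0; intros; apply Rabs_pos).
    assert (Y0 : 0 < Rabs y) by (apply Rabs_pos_lt; assumption).
    assert (S1 : Rabs (sin (PI * y)) <= PI * Rabs y).
    { eapply Rle_trans; [apply Rabs_sin_le|]. rewrite Rabs_mult, (Rabs_right PI); lra. }
    assert (S2 : PI * Rabs y / INR q / 8 <= Rabs (sin (PI * y / INR q))).
    { replace (Rabs (sin (PI * y / INR q))) with (Rabs (sin (PI * Rabs y / INR q))).
      - eapply Rle_trans; [|apply Rle_abs]. apply sin_ge_linear; split.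
        + apply Rmult_le_pos; [nra|left; apply Rinv_0_lt_compat; lra].
        + apply Rmult_le_reg_r with (INR q); [lra|].
          unfold Rdiv; rewrite (Rmult_assoc (PI * Rabs y)), Rinv_l by lra. nra.
      - destruct (Rle_dec 0 y).
        + rewrite (Rabs_right y) by lra; reflexivity.
        + rewrite (Rabs_left y) by lra.
          replace (PI * - y / INR q) with (- (PI * y / INR q)) by (field; lra).
          rewrite sin_neg, Rabs_Ropp; reflexivity. }
    rewrite !Rabs_mult, (Rabs_right 2) in E by lra.
    (* The full product is at most [2 PI |y|] and its first factor at least [2 PI |y| / (8 q)]; the
       quotient of these is [8 q]. *)
    apply Rmult_le_reg_l with (PI * Rabs y / INR q / 8).
    - repeat (apply Rdiv_lt_0_compat; try lra); nra.
    - replace (PI * Rabs y / INR q / 8 * (8 * INR q)) with (PI * Rabs y) by (field; lra).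
      assert (PI * Rabs y / INR q / 8 * O <= Rabs (sin (PI * y / INR q)) * O)
        by (apply Rmult_le_compat_r; assumption).
      lra. }
  intros Hy; destruct (Req_dec y 0) as [->|Hy0]; [|apply NZ; assumption].
  apply Rnot_lt_le; intros C.
  set (G := fun y => prodN (fun i => Rabs (2 * sin (PI * (INR (1 + i) + y) / INR q))) (q - 1)).
  assert (HG : continuity G).
  { apply (continuity_prodN
      (fun i y => Rabs (2 * sin (PI * (INR (1 + i) + y) / INR q)))); intros i.
    apply (continuity_comp (fun y => 2 * sin (PI * (INR (1 + i) + y) / INR q)) Rabs);
      [reg; lra|apply Rcontinuity_abs]. }
  destruct (HG 0 (G 0 - 8 * INR q)) as [d [Hd Hc]]; [unfold G; lra|].
  set (e := Rmin (d / 2) (/ 2)).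
  assert (He : 0 < e /\ e <= / 2 /\ e < d).
  { unfold e; pose proof (Rmin_l (d / 2) (/ 2)); pose proof (Rmin_r (d / 2) (/ 2)).
    repeat split; try lra. apply Rmin_glb_lt; lra. }
  specialize (Hc e).
  assert (Rabs (G e - G 0) < G 0 - 8 * INR q).
  { apply Hc; split; [split; [exact I|lra]|].
    simpl; unfold R_dist; rewrite Rabs_right; lra. }
  pose proof (NZ e ltac:(lra) ltac:(rewrite Rabs_right; lra)) as N; fold (G e) in N.
  pose proof (Rle_abs (- (G e - G 0))) as B; rewrite Rabs_Ropp in B. lra.
Qed.

Lemma exp_sub_1_le (t : R) : 0 <= t <= / 2 -> exp t - 1 <= 2 * t.
Proof.
  intros Ht; pose proof (exp_ineq1_le (- t)) as E; rewrite exp_Ropp in E.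
  pose proof (exp_pos t).
  assert (M : exp t * (1 - t) <= 1).
  { apply Rle_trans with (exp t * / exp t); [apply Rmult_le_compat_l; lra|].
    rewrite Rinv_r; lra. }
  nra.
Qed.

Section CyclicProduct.

Variables (q : nat) (r z y eta L : R) (p' : Z).
Hypothesis q_pos : (1 <= q)%nat.
Hypothesis r_rational : INR q * r = IZR p'.
Hypothesis y_le : Rabs y <= / 2.
Hypothesis eta_pos : 0 <= eta.
Hypothesis L_pos : 0 <= L.
Hypothesis eta_small : 1024 * (eta * (L + 1)) <= 1.
Hypothesis discrepancy : forall (A : nat -> R) (H : nat), (H < q)%nat ->
  (forall n, exists z', Rabs (A n) = Rabs (psi_sum r z' n)) ->
  sumN (fun i => Rabs (A (1 + i)%nat) * (/ INR (1 + i) - / INR (1 + i + 1))) H <= L.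

(** Twice the exponent of a half product; [eta_small] says that [tau <= / 2]. *)
Let tau : R := 512 * (eta * (L + 1)).
Let h (m : nat) : R := PI * (eta * psi (z + INR m * r)) / INR q.
Let u (m : nat) : R := PI * (INR m + y) / INR q.
Let full (m : nat) : R := Rabs (2 * sin (u m)).
Let pert (m : nat) : R := Rabs (2 * sin (u m - h m)).

Lemma eta_le_inv_20 : 0 <= eta <= / 20.
Proof. split; [assumption|nra]. Qed.

(** The nodes 1 to [q - 1] are cut in the middle. The upper half is reflected by
    [sin (PI - x) = sin x], which replaces [y] by [- y] and runs along the orbit backwards from
    [q]. *)
Lemma punctured_product_perturbation :
  prodN (fun i => full (1 + i)) (q - 1) * exp (- tau)
    <= prodN (fun i => pert (1 + i)) (q - 1)
    <= prodN (fun i => full (1 + i)) (q - 1) * exp tau.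
Proof.
  destruct (Nat.eq_dec q 1) as [E1|N1].
  (* For [q = 1] the products are empty; the half products require [q >= 2]. *)
  { rewrite E1; simpl.
    assert (0 <= tau) by (unfold tau; nra).
    pose proof (exp_le (- tau) 0 ltac:(lra)); pose proof (exp_le 0 tau ltac:(lra)).
    rewrite exp_0 in *; lra. }
  assert (q2 : 2 <= INR q) by (apply (le_INR 2); lia).
  set (H1 := ((q - 1) / 2)%nat); set (H2 := (q - 1 - H1)%nat).
  assert (HH1 : (2 * H1 <= q - 1)%nat).
  { unfold H1; apply Nat.Div0.mul_div_le. }
  assert (HH2 : (2 * H2 <= q)%nat).
  { unfold H2; pose proof (Nat.div_mod_eq (q - 1) 2) as D; fold H1 in D.
    pose proof (Nat.mod_upper_bound (q - 1) 2 ltac:(lia)); lia. }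
  assert (SP : forall F : nat -> R, prodN (fun i => F (1 + i)%nat) (q - 1)
    = prodN (fun i => F (1 + i)%nat) H1 * prodN (fun i => F (q - (1 + i))%nat) H2).
  { intros F; replace (q - 1)%nat with (H1 + H2)%nat by lia; rewrite prodN_add; f_equal.
    rewrite <- prodN_rev; apply prodN_ext; intros i Hi; f_equal; lia. }
  rewrite (SP full), (SP pert).
  set (f1 := fun i => - psi (z + INR (1 + i) * r)).
  set (f2 := fun i => psi (z - INR (1 + i) * r)).
  assert (B1 : forall i, Rabs (f1 i) <= / 2)
    by (intros; unfold f1; rewrite Rabs_Ropp; apply psi_bound).
  assert (B2 : forall i, Rabs (f2 i) <= / 2) by (intros; apply psi_bound).
  assert (D1 : sumN (fun i => Rabs (sumN f1 (1 + i)) * (/ INR (1 + i) - / INR (1 + i + 1))) H1 <= L).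
  { apply (discrepancy (sumN f1)); [lia|]; intros n; exists (z + r).
    replace (sumN f1 n) with (- psi_sum r (z + r) n); [apply Rabs_Ropp|].
    rewrite <- psi_sum_shift.
    transitivity (-1 * sumN (fun i => psi (z + INR (1 + i) * r)) n); [ring|].
    rewrite <- sumN_scal; apply sumN_ext; intros; unfold f1; ring. }
  assert (D2 : sumN (fun i => Rabs (sumN f2 (1 + i)) * (/ INR (1 + i) - / INR (1 + i + 1))) H2 <= L).
  { apply (discrepancy (sumN f2)); [lia|]; intros n; exists (z - INR n * r).
    unfold f2; rewrite psi_sum_backward; reflexivity. }
  assert (y_le' : Rabs (- y) <= / 2) by (rewrite Rabs_Ropp; assumption).
  pose proof (half_product_perturbation q H1 y eta L f1 ltac:(lia) ltac:(lia) y_le eta_le_inv_20 B1 D1)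
    as P1.
  pose proof (half_product_perturbation q H2 (- y) eta L f2 ltac:(lia) ltac:(lia) y_le' eta_le_inv_20 B2 D2)
    as P2.
  cbv zeta in P1, P2.
  rewrite (prodN_ext (fun i => Rabs (2 * sin (_ + _))) (fun i => pert (1 + i)) H1) in P1.
  2: { intros i Hi; unfold pert, u, h, f1; do 3 f_equal; field; lra. }
  change (prodN (fun i => Rabs (2 * sin (PI * (INR (1 + i) + y) / INR q))) H1)
    with (prodN (fun i => full (1 + i)) H1) in P1.
  assert (R2 : forall i, (i < H2)%nat ->
    u (q - (1 + i)) = PI - PI * (INR (1 + i) + - y) / INR q).
  { intros i Hi; unfold u; rewrite minus_INR by lia; field; lra. }
  rewrite (prodN_ext (fun i => Rabs (2 * sin (PI * (INR (1 + i) + - y) / INR q)))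
    (fun i => full (q - (1 + i)))) in P2.
  2: { intros i Hi; unfold full; rewrite R2 by assumption.
       rewrite Rtrigo_facts.sin_pi_minus; reflexivity. }
  rewrite (prodN_ext (fun i => Rabs (2 * sin (_ + _))) (fun i => pert (q - (1 + i))) H2) in P2.
  2: { intros i Hi; unfold pert; rewrite R2 by assumption.
       rewrite <- (Rtrigo_facts.sin_pi_minus (_ + _)); do 3 f_equal.
       unfold h, f2; rewrite minus_INR by lia.
       (* Since [q r] is an integer, the node [q - n] carries the same sawtooth value as [- n]. *)
       replace (z + (INR q - INR (1 + i)) * r) with (z - INR (1 + i) * r + IZR p')
         by (rewrite <- r_rational; ring).
       rewrite psi_shift; field; lra. }
  set (A1 := prodN (fun i => full (1 + i)) H1) in *.
  set (A2 := prodN (fun i => full (q - (1 + i))) H2) in *.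
  assert (A1p : 0 <= A1) by (apply prodN_ge0; intros; apply Rabs_pos).
  assert (A2p : 0 <= A2) by (apply prodN_ge0; intros; apply Rabs_pos).
  set (T := 256 * eta * (L + 1)) in *.
  replace tau with (T + T) by (unfold T, tau; ring).
  rewrite Ropp_plus_distr, !exp_plus.
  pose proof (exp_pos T); pose proof (exp_pos (- T)).
  split.
  - replace (A1 * A2 * (exp (- T) * exp (- T)))
      with ((A1 * exp (- T)) * (A2 * exp (- T))) by ring.
    apply Rmult_le_compat; try (apply Rmult_le_pos; lra); lra.
  - replace (A1 * A2 * (exp T * exp T)) with ((A1 * exp T) * (A2 * exp T)) by ring.
    apply Rmult_le_compat; try (apply prodN_ge0; intros; apply Rabs_pos); lra.
Qed.

(** The sine at node 0 may vanish, so its change is estimated additively: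
    [full 0 (O' - O) + (pert 0 - full 0) O']. The first part is at most [2] times [2 tau]; the
    second is at most [64 eta <= tau], because [O'] is [O (q)] while the factor moves by
    [O (eta / q)]. *)
Lemma cyclic_product_perturbation :
  Rabs (prodN pert q - Rabs (2 * sin (PI * y))) <= 5 * tau.
Proof.
  assert (q1 : 1 <= INR q) by (apply (le_INR 1); assumption).
  pose proof PI_RGT_0 as P0; pose proof PI_4 as P4.
  pose proof punctured_product_perturbation as PP.
  pose proof (punctured_sine_product_le q y q_pos y_le) as OB.
  change (prodN (fun i => full (1 + i)) (q - 1) <= 8 * INR q) in OB.
  rewrite <- (SineProduct.prod_sin q y q_pos).
  change (prodN _ q) with (prodN full q) at 2.
  assert (T2 : prodN full q <= 2).
  { unfold full, u; rewrite SineProduct.prod_sin by assumption.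
    rewrite Rabs_mult, (Rabs_right 2) by lra.
    assert (Rabs (sin (PI * y)) <= 1); [|lra].
    pose proof (SIN_bound (PI * y)); apply Rabs_le; lra. }
  rewrite (prodN_head full) in T2 |- * by assumption; rewrite (prodN_head pert) by assumption.
  set (O := prodN (fun i => full (1 + i)) (q - 1)) in *.
  set (O' := prodN (fun i => pert (1 + i)) (q - 1)) in *.
  assert (O0 : 0 <= O) by (apply prodN_ge0; intros; apply Rabs_pos).
  assert (eT : 512 * eta <= tau) by (unfold tau; nra).
  assert (TT : 0 <= tau <= / 2) by (unfold tau in *; nra).
  pose proof (exp_sub_1_le tau TT) as EB.
  assert (EL : 1 - exp (- tau) <= 2 * tau) by (pose proof (exp_ineq1_le (- tau)); lra).
  assert (F0 : 0 <= full 0) by apply Rabs_pos.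
  assert (DF : Rabs (pert 0 - full 0) <= 4 * eta / INR q).
  { unfold pert, full. eapply Rle_trans; [apply Rabs_triang_inv2|].
    replace (2 * sin (u 0 - h 0) - 2 * sin (u 0))
      with (2 * (sin (u 0 - h 0) - sin (u 0))) by ring.
    rewrite Rabs_mult, (Rabs_right 2) by lra.
    pose proof (Rabs_sin_sub_le (u 0 - h 0) (u 0)) as S.
    replace (u 0 - h 0 - u 0) with (- h 0) in S by ring; rewrite Rabs_Ropp in S.
    assert (Hh : Rabs (h 0) <= 2 * eta / INR q).
    { unfold h, Rdiv; rewrite !Rabs_mult, Rabs_inv, (Rabs_right PI), (Rabs_right eta),
        (Rabs_right (INR q)) by lra.
      apply Rmult_le_compat_r; [left; apply Rinv_0_lt_compat; lra|].
      pose proof (psi_bound (z + INR 0 * r)); pose proof (Rabs_pos (psi (z + INR 0 * r))).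
      apply Rle_trans with (4 * (eta * / 2)); [|lra].
      apply Rmult_le_compat; try nra. }
    unfold Rdiv in *; lra. }
  replace (pert 0 * O' - full 0 * O) with (full 0 * (O' - O) + (pert 0 - full 0) * O') by ring.
  eapply Rle_trans; [apply Rabs_triang|]; rewrite !Rabs_mult.
  rewrite (Rabs_right (full 0)) by lra.
  assert (D1 : Rabs (O' - O) <= O * (2 * tau)).
  { apply Rabs_le; split; nra. }
  assert (O'0 : 0 <= O') by (apply prodN_ge0; intros; apply Rabs_pos).
  rewrite (Rabs_right O') by lra.
  assert (D2 : full 0 * Rabs (O' - O) <= 4 * tau).
  { apply Rle_trans with (full 0 * (O * (2 * tau))).
    - apply Rmult_le_compat_l; assumption.
    - replace (full 0 * (O * (2 * tau))) with (full 0 * O * (2 * tau)) by ring. nra. }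
  assert (D3 : Rabs (pert 0 - full 0) * O' <= 64 * eta).
  { apply Rle_trans with (4 * eta / INR q * (16 * INR q)).
    - apply Rmult_le_compat; try apply Rabs_pos; try assumption. nra.
    - right; field; lra. }
  lra.
Qed.

End CyclicProduct.

(** * Sudler products as perturbed sine products *)

Lemma P_prodN (N : nat) (alpha x : R) :
  P N alpha x = prodN (fun i => Rabs (2 * sin (PI * (INR (S i) * alpha + x)))) N.
Proof. induction N as [|N IH]; [reflexivity|]. cbn [P prodN]; rewrite IH; reflexivity. Qed.

Lemma Rabs_sin_period (x : R) (d : Z) : Rabs (sin (x + IZR d * PI)) = Rabs (sin x).
Proof.
  rewrite sin_plus, (sin_eq_0_1 (IZR d * PI)) by (exists d; reflexivity).
  rewrite Rmult_0_r, Rplus_0_r, Rabs_mult.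
  assert (C : Rsqr (cos (IZR d * PI)) = Rsqr 1).
  { pose proof (sin2_cos2 (IZR d * PI)) as H.
    rewrite (sin_eq_0_1 (IZR d * PI)) in H by (exists d; reflexivity).
    unfold Rsqr in *; lra. }
  apply Rsqr_eq_abs_0 in C; rewrite C, Rabs_R1; ring.
Qed.

Section Estimate.

Variables (alpha delta L : R) (q : nat) (p q' p' s : Z).
Hypothesis q_pos : (1 <= q)%nat.
Hypothesis s_sign : s = 1%Z \/ s = (-1)%Z.
Hypothesis det : (p * q' - p' * Z.of_nat q = - s)%Z.
Hypothesis delta_pos : 0 <= delta.
Hypothesis delta_eq : INR q * alpha - IZR p = IZR s * delta.
Hypothesis L_pos : 0 <= L.
Hypothesis small : 1024 * (INR q * delta * (L + 1)) <= 1.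
Hypothesis discrepancy : forall (A : nat -> R) (H : nat), (H < q)%nat ->
  (forall n, exists z', Rabs (A n) = Rabs (psi_sum (IZR q' / INR q) z' n)) ->
  sumN (fun i => Rabs (A (1 + i)%nat) * (/ INR (1 + i) - / INR (1 + i + 1))) H <= L.

Let eta : R := INR q * delta.
Let r : R := IZR q' / INR q.

(** Put [m = s p n]. The determinant gives [m q' = - n] modulo [q], so [psi (m r) = / 2 - n / q],
    and the displacement [n delta = eta n / q] of the [n]-th factor equals
    [eta / 2 - eta psi (m r)]. The integer [c] is a free rotation of the cyclic product. *)
Lemma P_cyclic (x : R) (c : Z) :
  P q alpha (IZR s * x / INR q)
  = prodN (fun m => Rabs (2 * sin (PI * (INR m + (x + eta / 2 + IZR c)) / INR q
      - PI * (eta * psi (IZR c * r + INR m * r)) / INR q))) q.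
Proof.
  assert (q1 : 1 <= INR q) by (apply (le_INR 1); assumption).
  assert (ss : (s * s = 1)%Z) by (destruct s_sign as [-> | ->]; reflexivity).
  set (F := fun m : Z => Rabs (2 * sin (PI * (IZR m + (x + eta / 2)) / INR q
      - PI * (eta * psi (IZR m * r)) / INR q))).
  assert (Fper : forall m, F (m mod Z.of_nat q)%Z = F m).
  { intros m; unfold F.
    assert (Em : IZR m = IZR (m mod Z.of_nat q) + INR q * IZR (m / Z.of_nat q)).
    { rewrite INR_IZR_INZ, <- mult_IZR, <- plus_IZR; f_equal.
      pose proof (Z.div_mod m (Z.of_nat q) ltac:(lia)); lia. }
    rewrite Em.
    replace ((IZR (m mod Z.of_nat q) + INR q * IZR (m / Z.of_nat q)) * r)
      with (IZR (m mod Z.of_nat q) * r + IZR (m / Z.of_nat q * q'))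
      by (rewrite mult_IZR; unfold r; field; lra).
    rewrite psi_shift, !Rabs_mult; f_equal.
    rewrite <- (Rabs_sin_period _ (m / Z.of_nat q)); do 2 f_equal; field; lra. }
  assert (U1 : rel_prime (s * p) (Z.of_nat q)).
  { apply bezout_rel_prime, Bezout_intro with (- q')%Z (p' * s)%Z.
    replace (- q' * (s * p) + p' * s * Z.of_nat q)%Z
      with (- s * (p * q' - p' * Z.of_nat q))%Z by ring.
    rewrite det; lia. }
  rewrite P_prodN.
  (* The offset [s p] appears because index [i] stands for [n = i + 1]. *)
  rewrite (prodN_ext _ (fun i => F (s * p * Z.of_nat i + s * p)%Z)).
  - pose proof (prodN_reindex (Z.of_nat q) (s * p) (s * p) ltac:(lia) U1 F Fper) as R1.
    pose proof (prodN_reindex (Z.of_nat q) 1 c ltac:(lia) (rel_prime_1 _) F Fper) as R2.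
    rewrite Nat2Z.id in R1, R2; rewrite R1, <- R2.
    apply prodN_ext; intros i _; unfold F.
    rewrite plus_IZR, Z.mul_1_l, <- INR_IZR_INZ.
    do 3 f_equal.
    replace ((INR i + IZR c) * r) with (IZR c * r + INR i * r) by ring.
    field; lra.
  - intros i Hi; unfold F.
    replace (s * p * Z.of_nat i + s * p)%Z with (s * p * Z.of_nat (S i))%Z by lia.
    set (n := S i).
    assert (Hn : 1 <= INR n <= INR q) by (split; [apply (le_INR 1)|apply le_INR]; lia).
    assert (Epsi : psi (IZR (s * p * Z.of_nat n) * r) = / 2 - INR n / INR q).
    { replace (IZR (s * p * Z.of_nat n) * r)
        with (- INR n / INR q + IZR (s * p' * Z.of_nat n)).
      - rewrite psi_shift; unfold psi.
        assert (I : / INR q * INR q = 1) by (field; lra).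
        assert (I0 : 0 < / INR q) by (apply Rinv_0_lt_compat; lra).
        (* [- n / q] has floor [-1] for all [1 <= n <= q], the last one included, where [psi] takes
           its value [- / 2]. *)
        rewrite (frac_part_unique _ (-1)); unfold Rdiv; [lra|]. split; nra.
      - assert (DR : IZR p * IZR q' - IZR p' * INR q = - IZR s).
        { rewrite INR_IZR_INZ, <- !mult_IZR, <- minus_IZR, <- opp_IZR, det; reflexivity. }
        assert (SR : IZR s * IZR s = 1) by (rewrite <- mult_IZR, ss; reflexivity).
        rewrite !mult_IZR, <- INR_IZR_INZ; unfold r.
        apply Rmult_eq_reg_r with (INR q); [|lra].
        replace ((- INR n / INR q + IZR s * IZR p' * INR n) * INR q)
          with (INR n * (- (1) + IZR s * (IZR p' * INR q))) by (field; lra).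
        replace (IZR s * IZR p * INR n * (IZR q' / INR q) * INR q)
          with (INR n * (IZR s * (IZR p * IZR q'))) by (field; lra).
        f_equal. replace (IZR p * IZR q') with (IZR p' * INR q - IZR s) by lra.
        rewrite <- SR at 1; ring. }
    rewrite Epsi, !Rabs_mult; f_equal.
    assert (EA : alpha = (IZR p + IZR s * delta) / INR q).
    { apply Rmult_eq_reg_l with (INR q); [|lra].
      replace (INR q * ((IZR p + IZR s * delta) / INR q))
        with (IZR p + IZR s * delta) by (field; lra). lra. }
    rewrite EA, !mult_IZR, <- INR_IZR_INZ; unfold eta.
    destruct s_sign as [-> | ->].
    + do 2 f_equal; field; lra.
    + rewrite <- Rabs_Ropp, <- sin_neg; do 2 f_equal; field; lra.
Qed.

Lemma P_estimate (x : R) :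
  Rabs (P q alpha (IZR s * x / INR q) - Rabs (2 * sin (PI * x)))
  <= 3000 * (INR q * delta * (L + 1)).
Proof.
  assert (q1 : 1 <= INR q) by (apply (le_INR 1); assumption).
  pose proof PI_RGT_0 as P0; pose proof PI_4 as P4.
  (* Minus the nearest integer, so that the zero closest to the shifted nodes belongs to node 0. *)
  set (c := (- Int_part (x + eta / 2 + / 2))%Z).
  set (y := x + eta / 2 + IZR c).
  assert (y_le : Rabs y <= / 2).
  { pose proof (base_Int_part (x + eta / 2 + / 2)).
    apply Rabs_le; unfold y, c; rewrite opp_IZR; lra. }
  assert (e0 : 0 <= eta) by (apply Rmult_le_pos; lra).
  assert (rq : INR q * r = IZR q') by (unfold r; field; lra).
  pose proof (cyclic_product_perturbation q r (IZR c * r) y eta L q'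
    q_pos rq y_le e0 L_pos small discrepancy) as C.
  unfold y in C at 1; rewrite <- P_cyclic in C.
  assert (D : Rabs (Rabs (2 * sin (PI * y)) - Rabs (2 * sin (PI * x))) <= 4 * eta).
  { assert (Ey : Rabs (2 * sin (PI * y)) = Rabs (2 * sin (PI * (x + eta / 2)))).
    { rewrite !Rabs_mult; f_equal.
      rewrite <- (Rabs_sin_period (PI * (x + eta / 2)) c); do 2 f_equal; unfold y; ring. }
    rewrite Ey; eapply Rle_trans; [apply Rabs_triang_inv2|].
    replace (2 * sin (PI * (x + eta / 2)) - 2 * sin (PI * x))
      with (2 * (sin (PI * (x + eta / 2)) - sin (PI * x))) by ring.
    rewrite Rabs_mult, (Rabs_right 2) by lra.
    pose proof (Rabs_sin_sub_le (PI * (x + eta / 2)) (PI * x)) as SB.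
    replace (PI * (x + eta / 2) - PI * x) with (PI * (eta / 2)) in SB by ring.
    rewrite (Rabs_right (PI * (eta / 2))) in SB by nra. nra. }
  replace (P q alpha (IZR s * x / INR q) - Rabs (2 * sin (PI * x)))
    with ((P q alpha (IZR s * x / INR q) - Rabs (2 * sin (PI * y)))
      + (Rabs (2 * sin (PI * y)) - Rabs (2 * sin (PI * x)))) by ring.
  eapply Rle_trans; [apply Rabs_triang|].
  fold eta. assert (eta <= eta * (L + 1)) by nra. lra.
Qed.

End Estimate.

(** * Continued fractions *)

(** Initial values [(0, 1)] yield the denominators and [(1, 0)] the numerators of
    [[0; b 0, b 1, ...]], both starting at the convergent of index -1. *)
Fixpoint continuant_pair (b : nat -> nat) (u v : nat) (j : nat) : nat * nat :=
  match j with
  | O => (u, v)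
  | S j' => let (x, y) := continuant_pair b u v j' in (y, (b j' * y + x)%nat)
  end.

Definition continuant (b : nat -> nat) (u v j : nat) : nat := fst (continuant_pair b u v j).

Lemma continuant_pair_eq b u v j :
  continuant_pair b u v j = (continuant b u v j, continuant b u v (S j)).
Proof.
  unfold continuant; simpl; destruct (continuant_pair b u v j); reflexivity.
Qed.

Lemma continuant_SS b u v j :
  continuant b u v (S (S j)) = (b j * continuant b u v (S j) + continuant b u v j)%nat.
Proof.
  unfold continuant at 1; cbn [continuant_pair].
  rewrite continuant_pair_eq; reflexivity.
Qed.

Lemma continuant_det b j :
  (Z.of_nat (continuant b 0 1 (S j)) * Z.of_nat (continuant b 1 0 j)
   - Z.of_nat (continuant b 0 1 j) * Z.of_nat (continuant b 1 0 (S j)) = (-1) ^ Z.of_nat j)%Z.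
Proof.
  induction j as [|j IH]; [reflexivity|].
  rewrite !continuant_SS, Nat2Z.inj_succ, Z.pow_succ_r by lia.
  rewrite <- IH, !Nat2Z.inj_add, !Nat2Z.inj_mul; ring.
Qed.

Lemma pow_m1_sign (j : nat) : ((-1) ^ Z.of_nat j = 1 \/ (-1) ^ Z.of_nat j = -1)%Z.
Proof.
  induction j as [|j IH]; [left; reflexivity|].
  rewrite Nat2Z.inj_succ, Z.pow_succ_r by lia. lia.
Qed.

Lemma continuant_coprime b j :
  rel_prime (Z.of_nat (continuant b 1 0 (S j))) (Z.of_nat (continuant b 0 1 (S j))).
Proof.
  pose proof (continuant_det b j) as D; pose proof (pow_m1_sign j) as Hs.
  set (s := ((-1) ^ Z.of_nat j)%Z) in *.
  apply bezout_rel_prime, Bezout_intro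
    with (- s * Z.of_nat (continuant b 0 1 j))%Z (s * Z.of_nat (continuant b 1 0 j))%Z.
  transitivity (s * (Z.of_nat (continuant b 0 1 (S j)) * Z.of_nat (continuant b 1 0 j)
    - Z.of_nat (continuant b 0 1 j) * Z.of_nat (continuant b 1 0 (S j))))%Z; [ring|].
  rewrite D; lia.
Qed.

Lemma continuant_mono b j : (forall i, (i < j)%nat -> (1 <= b i)%nat) ->
  (continuant b 0 1 j <= continuant b 0 1 (S j))%nat.
Proof.
  destruct j as [|j]; intros H; [unfold continuant; simpl; lia|].
  rewrite continuant_SS; specialize (H j ltac:(lia)); nia.
Qed.

Section Expansion.

Variable alpha : R.
Hypothesis alpha_irr : irrational alpha.

(** Faithful for [i >= 1], where the floor is positive; [a_0] may be negative. *)
Definition pquot (i : nat) : nat := Z.to_nat (Int_part (cf_x alpha i)).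

(* Shifted by one with respect to [cf_q]: [qden 0 = q_(-1) = 0] and
   [qden (S k) = q_k]. *)
Definition qden (i : nat) : nat := continuant (fun j => pquot (S j)) 0 1 i.

Lemma cf_q_qden k : cf_q alpha k = qden (S k).
Proof.
  assert (E : cf_q_pair alpha k = continuant_pair (fun j => pquot (S j)) 0 1 k).
  { induction k as [|k IH]; [reflexivity|]. cbn [cf_q_pair continuant_pair].
    rewrite IH; reflexivity. }
  unfold cf_q; rewrite E, continuant_pair_eq; reflexivity.
Qed.

Lemma irrational_shift_inv (x : R) (n : Z) :
  irrational x -> x - IZR n <> 0 /\ irrational (/ (x - IZR n)).
Proof.
  intros Hx.
  assert (N : x - IZR n <> 0).
  { intros E; apply (Hx n 1%Z); [lia|]. unfold Rdiv; rewrite Rinv_1; lra. }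
  split; [exact N|]. intros p q Hq E.
  assert (q <> 0%Z -> IZR q <> 0) by (intros; apply not_0_IZR; assumption).
  assert (Hp : p <> 0%Z).
  { intros ->. apply (Rinv_neq_0_compat _ N). rewrite E; unfold Rdiv; ring. }
  apply (Hx (q + n * p)%Z p Hp).
  assert (IZR p <> 0) by (apply not_0_IZR; assumption).
  assert (E' : x - IZR n = IZR q / IZR p).
  { rewrite <- (Rinv_inv (x - IZR n)), E; field; auto. }
  rewrite plus_IZR, mult_IZR. replace x with (x - IZR n + IZR n) by ring.
  rewrite E'; field; assumption.
Qed.

Lemma cf_x_irrational k : irrational (cf_x alpha k).
Proof.
  induction k as [|k IH]; [exact alpha_irr|].
  apply irrational_shift_inv; exact IH.
Qed.

Lemma cf_x_frac k : 0 < cf_x alpha k - floorR (cf_x alpha k) < 1.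
Proof.
  pose proof (base_Int_part (cf_x alpha k)) as B.
  destruct (irrational_shift_inv _ (Int_part (cf_x alpha k)) (cf_x_irrational k)) as [N _].
  unfold floorR; lra.
Qed.

Lemma cf_x_gt_1 k : 1 < cf_x alpha (S k).
Proof.
  pose proof (cf_x_frac k); cbn [cf_x]. rewrite <- Rinv_1 at 1.
  apply Rinv_lt_contravar; lra.
Qed.

Lemma Int_part_pos k : (1 <= Int_part (cf_x alpha (S k)))%Z.
Proof.
  pose proof (cf_x_gt_1 k); pose proof (base_Int_part (cf_x alpha (S k))) as B.
  assert (0 < Int_part (cf_x alpha (S k)))%Z by (apply lt_IZR; lra). lia.
Qed.

Lemma pquot_pos i : (1 <= i)%nat -> (1 <= pquot i)%nat.
Proof.
  destruct i as [|i]; [lia|]; intros _; pose proof (Int_part_pos i); unfold pquot; lia.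
Qed.

Lemma cf_a_pquot i : (1 <= i)%nat -> cf_a alpha i = INR (pquot i).
Proof.
  destruct i as [|i]; [lia|]; intros _; pose proof (Int_part_pos i).
  unfold cf_a, floorR, pquot; rewrite INR_IZR_INZ, Z2Nat.id; [reflexivity|lia].
Qed.

Lemma cf_a_ge_1 i : (1 <= i)%nat -> 1 <= cf_a alpha i.
Proof.
  intros H; rewrite cf_a_pquot by assumption.
  apply (le_INR 1), pquot_pos; assumption.
Qed.

Lemma qden_SS i : qden (S (S i)) = (pquot (S i) * qden (S i) + qden i)%nat.
Proof. apply continuant_SS. Qed.

Lemma qden_mono i : (qden i <= qden (S i))%nat.
Proof. apply continuant_mono; intros; apply pquot_pos; lia. Qed.

Lemma qden_pos i : (1 <= qden (S i))%nat.
Proof.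
  induction i as [|i IH]; [unfold qden, continuant; simpl; lia|].
  pose proof (qden_mono (S i)); lia.
Qed.

(** The bound [2 q_k + q_(k-1)] is inductive by [q_k + q_(k-1) <= q_(k+1)]; this is the form in
    which geometric growth enters. *)
Lemma sum_qden_le k : sumN (fun i => INR (qden (S (S i)))) k <= 3 * INR (qden (S k)).
Proof.
  assert (H : sumN (fun i => INR (qden (S (S i)))) k <= 2 * INR (qden (S k)) + INR (qden k)).
  { induction k as [|k IH].
    - pose proof (pos_INR (qden 1)); pose proof (pos_INR (qden 0)); simpl; lra.
    - cbn [sumN].
      assert (E : INR (qden (S k)) + INR (qden k) <= INR (qden (S (S k)))).
      { rewrite <- plus_INR; apply le_INR; rewrite qden_SS.
        pose proof (pquot_pos (S k) ltac:(lia)); nia. }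
      lra. }
  pose proof (le_INR _ _ (qden_mono k)); lra.
Qed.

(** [delta = |q_k alpha - p_k|], and the complete quotient [cf_x alpha (S k)] is the ratio of the
    previous such distance to this one. The induction starts from [p_0 = a_0] and [p_(-1) = 1]. *)
Lemma convergent_data k : exists (p p' s : Z) (delta : R),
  (s = 1%Z \/ s = (-1)%Z) /\ IZR s = (-1) ^ k /\
  (p * Z.of_nat (qden k) - p' * Z.of_nat (qden (S k)) = - s)%Z /\
  0 < delta /\ INR (qden (S k)) * alpha - IZR p = IZR s * delta /\
  INR (qden k) * alpha - IZR p' = - (IZR s * (delta * cf_x alpha (S k))).
Proof.
  induction k as [|k (p & p' & s & delta & Hs & Es & D & Dp & E1 & E2)].
  - exists (Int_part alpha), 1%Z, 1%Z, (alpha - floorR alpha).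
    pose proof (cf_x_frac 0) as F; cbn [cf_x] in F |- *.
    unfold qden, continuant; cbn -[IZR]; unfold floorR in *.
    repeat split; try lra; try lia. field; lra.
  - exists (Z.of_nat (pquot (S k)) * p + p')%Z, p, (- s)%Z,
      (delta * (cf_x alpha (S k) - floorR (cf_x alpha (S k)))).
    pose proof (cf_x_frac (S k)) as F.
    assert (Ea : INR (pquot (S k)) = floorR (cf_x alpha (S k)))
      by (rewrite <- cf_a_pquot by lia; reflexivity).
    rewrite qden_SS.
    split; [lia|]. split; [rewrite opp_IZR, Es; simpl; ring|].
    split; [rewrite Nat2Z.inj_add, Nat2Z.inj_mul; lia|].
    split; [apply Rmult_lt_0_compat; lra|].
    split.
    + rewrite plus_INR, mult_INR, plus_IZR, mult_IZR, <- INR_IZR_INZ, opp_IZR, Ea.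
      set (a := floorR (cf_x alpha (S k))) in *.
      transitivity (a * (INR (qden (S k)) * alpha - IZR p) + (INR (qden k) * alpha - IZR p'));
        [ring|]. rewrite E1, E2; ring.
    + rewrite E1, opp_IZR.
      change (cf_x alpha (S (S k))) with (/ (cf_x alpha (S k) - floorR (cf_x alpha (S k)))).
      field; lra.
Qed.

(** * The reversed expansion of [q_(k-1) / q_k] *)

Section Reversed.

Variable k : nat.

(* [Q j] are the convergent denominators of [q_(k-1) / q_k = [0; a_k, ..., a_1]],
   and the numerators are [continuant b 1 0 (S j)]. *)
Let b (j : nat) : nat := pquot (k - j).
Let Q (j : nat) : nat := continuant b 0 1 (S j).

Lemma reversed_identities j : (j <= k)%nat ->
  qden (S k) = (Q j * qden (S (k - j)) + continuant b 0 1 j * qden (k - j))%nat /\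
  (Z.of_nat (Q j) * Z.of_nat (qden k)
    - Z.of_nat (continuant b 1 0 (S j)) * Z.of_nat (qden (S k))
    = (-1) ^ Z.of_nat j * Z.of_nat (qden (k - j)))%Z /\
  (Z.of_nat (continuant b 0 1 j) * Z.of_nat (qden k)
    - Z.of_nat (continuant b 1 0 j) * Z.of_nat (qden (S k))
    = - (-1) ^ Z.of_nat j * Z.of_nat (qden (S (k - j))))%Z.
Proof.
  unfold Q; induction j as [|j IH]; intros Hj.
  - rewrite Nat.sub_0_r.
    change (continuant b 0 1 1) with 1%nat; change (continuant b 0 1 0) with 0%nat.
    change (continuant b 1 0 1) with 0%nat; change (continuant b 1 0 0) with 1%nat.
    change ((-1) ^ Z.of_nat 0)%Z with 1%Z. lia.
  - destruct (IH ltac:(lia)) as (I1 & I2 & I3).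
    set (i := (k - S j)%nat) in *.
    assert (Ei : (k - j = S i)%nat) by lia.
    assert (Eb : b j = pquot (S i)) by (unfold b; rewrite Ei; reflexivity).
    rewrite Ei in *; rewrite qden_SS in I1, I3.
    rewrite !continuant_SS, Eb.
    rewrite Nat2Z.inj_succ, Z.pow_succ_r, !Nat2Z.inj_add, !Nat2Z.inj_mul by lia.
    rewrite Nat2Z.inj_add, Nat2Z.inj_mul in I3.
    split; [rewrite I1; ring|]. split; [|rewrite I2; ring].
    match goal with |- ((?a * ?x + ?y) * ?m - (?a * ?u + ?v) * ?n = _)%Z =>
      transitivity (a * (x * m - u * n) + (y * m - v * n))%Z; [ring|] end.
    rewrite I2, I3; ring.
Qed.

Lemma reversed_pquot_pos j : (j < k)%nat -> (1 <= b j)%nat.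
Proof. intros H; apply pquot_pos; lia. Qed.

Lemma reversed_continuant_le j : (j <= k)%nat -> (continuant b 0 1 j <= Q j)%nat.
Proof. intros H; apply continuant_mono; intros; apply reversed_pquot_pos; lia. Qed.

Lemma reversed_qden_pos j : (j <= k)%nat -> (1 <= Q j)%nat.
Proof.
  induction j as [|j IH]; intros H; [unfold Q, continuant; simpl; lia|].
  pose proof (reversed_continuant_le (S j) H); pose proof (IH ltac:(lia)); unfold Q in *; lia.
Qed.

(** Both terms of the first identity are at most [Q_j q_(k-j)]. This converts weights [1 / Q_j] into
    [q_l / q_k] with [l = k - j]. *)
Lemma inv_reversed_qden_le j : (j <= k)%nat ->
  / INR (Q j) <= 2 * (INR (qden (S (k - j))) / INR (qden (S k))).
Proof.
  intros Hj; destruct (reversed_identities j Hj) as [I _].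
  pose proof (reversed_continuant_le j Hj) as C; pose proof (qden_mono (k - j)) as M.
  pose proof (reversed_qden_pos j Hj) as Qp; pose proof (qden_pos k) as Kp.
  assert (U : (qden (S k) <= 2 * Q j * qden (S (k - j)))%nat).
  { rewrite I. replace (2 * Q j * qden (S (k - j)))%nat
      with (Q j * qden (S (k - j)) + Q j * qden (S (k - j)))%nat by ring.
    apply Nat.add_le_mono_l, Nat.mul_le_mono; assumption. }
  apply le_INR in U; rewrite !mult_INR in U; change (INR 2) with 2 in U.
  assert (0 < INR (Q j)) by (apply lt_0_INR; lia).
  assert (0 < INR (qden (S k))) by (apply lt_0_INR; lia).
  apply Rmult_le_reg_r with (INR (Q j) * INR (qden (S k))); [nra|].
  replace (/ INR (Q j) * (INR (Q j) * INR (qden (S k)))) with (INR (qden (S k)))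
    by (field; lra).
  replace (2 * (INR (qden (S (k - j))) / INR (qden (S k))) * (INR (Q j) * INR (qden (S k))))
    with (2 * INR (Q j) * INR (qden (S (k - j)))) by (field; lra). exact U.
Qed.

(** The approximation needed for a block holds because [Q_j q_(k-j-1) <= Q_j q_(k-j) <= q_k]. *)
Lemma block_bound j : (j < k)%nat ->
  forall z, Rabs (psi_sum (INR (qden k) / INR (qden (S k))) z (Q j)) <= 5.
Proof.
  intros Hj z; destruct (reversed_identities j ltac:(lia)) as (I1 & I2 & _).
  pose proof (reversed_qden_pos j ltac:(lia)) as Qp; pose proof (qden_pos k) as Kp.
  rewrite <- (Nat2Z.id (Q j)).
  apply psi_sum_block with (Z.of_nat (continuant b 1 0 (S j))); [lia|apply continuant_coprime|].
  assert (Q0 : 0 < INR (Q j)) by (apply lt_0_INR; lia).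
  assert (K0 : 0 < INR (qden (S k))) by (apply lt_0_INR; lia).
  rewrite <- !INR_IZR_INZ.
  assert (E : INR (Q j) * (INR (qden k) / INR (qden (S k))) - INR (continuant b 1 0 (S j))
    = IZR ((-1) ^ Z.of_nat j) * (INR (qden (k - j)) / INR (qden (S k)))).
  { apply Rmult_eq_reg_r with (INR (qden (S k))); [|lra].
    transitivity (INR (Q j) * INR (qden k) - INR (continuant b 1 0 (S j)) * INR (qden (S k)));
      [field; lra|].
    transitivity (IZR ((-1) ^ Z.of_nat j) * INR (qden (k - j))); [|field; lra].
    rewrite !INR_IZR_INZ, <- !mult_IZR, <- minus_IZR, I2; reflexivity. }
  rewrite E, Rabs_mult.
  replace (Rabs (IZR ((-1) ^ Z.of_nat j))) with 1.
  2: { destruct (pow_m1_sign j) as [-> | ->]; [rewrite Rabs_R1|rewrite Rabs_left]; lra. }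
  rewrite Rmult_1_l, Rabs_right.
  2: { apply Rle_ge, Rmult_le_pos; [apply pos_INR|left; apply Rinv_0_lt_compat; assumption]. }
  apply Rmult_le_reg_r with (INR (Q j) * INR (qden (S k))); [nra|].
  replace (/ INR (Q j) * (INR (Q j) * INR (qden (S k)))) with (INR (qden (S k)))
    by (field; lra).
  replace (INR (qden (k - j)) / INR (qden (S k)) * (INR (Q j) * INR (qden (S k))))
    with (INR (Q j) * INR (qden (k - j))) by (field; lra).
  rewrite <- mult_INR; apply le_INR. pose proof (qden_mono (k - j)); nia.
Qed.

(** The sum of [(1 + log a_l) q_l / q_k] over [1 <= l <= k], with [l = i + 1]. *)
Definition log_sum : R :=
  sumN (fun i => (1 + ln (cf_a alpha (S i))) * INR (qden (S (S i))) / INR (qden (S k))) k.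

Lemma ln_pquot_ge0 i : (1 <= i)%nat -> 0 <= ln (INR (pquot i)).
Proof.
  intros H; rewrite <- ln_1; apply ln_le; [lra|].
  apply (le_INR 1), pquot_pos; assumption.
Qed.

Lemma reversed_discrepancy (A : nat -> R) (H : nat) : (H < qden (S k))%nat ->
  (forall n, exists z, Rabs (A n) = Rabs (psi_sum (INR (qden k) / INR (qden (S k))) z n)) ->
  sumN (fun i => Rabs (A (1 + i)%nat) * (/ INR (1 + i) - / INR (1 + i + 1))) H
  <= 20 * log_sum.
Proof.
  intros HH HA.
  assert (EQ : Q k = qden (S k)).
  { destruct (reversed_identities k ltac:(lia)) as [I _]; rewrite Nat.sub_diag in I.
    change (qden 1) with 1%nat in I; change (qden 0) with 0%nat in I; lia. }
  eapply Rle_trans.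
  - apply (weighted_discrepancy (INR (qden k) / INR (qden (S k))) b Q k).
    + reflexivity.
    + apply reversed_pquot_pos.
    + intros j Hj; unfold Q; rewrite continuant_SS; lia.
    + intros j Hj; pose proof (reversed_continuant_le j ltac:(lia)); unfold Q in *.
      rewrite continuant_SS; lia.
    + apply block_bound.
    + exact HA.
    + rewrite EQ; exact HH.
  (* Reversal matches [j] with [l = k - j]. The constant is 5 times 2 from [2 + ln <= 2 (1 + ln)]
     times 2 from [1 / Q_j <= 2 q_l / q_k]. *)
  - unfold log_sum; rewrite <- (sumN_rev (fun i => (1 + ln (cf_a alpha (S i)))
      * INR (qden (S (S i))) / INR (qden (S k)))), <- !sumN_scal.
    apply sumN_le; intros j Hj.
    replace (S (k - 1 - j)) with (k - j)%nat by lia.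
    rewrite cf_a_pquot by lia; fold (b j).
    pose proof (inv_reversed_qden_le j ltac:(lia)) as IQ.
    pose proof (ln_pquot_ge0 (k - j) ltac:(lia)) as LP; fold (b j) in LP.
    unfold Rdiv in *; set (rho := INR (qden (S (k - j))) * / INR (qden (S k))) in *.
    replace (20 * ((1 + ln (INR (b j))) * INR (qden (S (k - j))) * / INR (qden (S k))))
      with (10 * ((1 + ln (INR (b j))) * (2 * rho))) by (unfold rho; ring).
    assert (0 < / INR (Q j)).
    { apply Rinv_0_lt_compat, lt_0_INR; pose proof (reversed_qden_pos j ltac:(lia)); lia. }
    assert ((1 + ln (INR (b j))) * / INR (Q j) <= (1 + ln (INR (b j))) * (2 * rho))
      by (apply Rmult_le_compat_l; lra).
    assert ((2 + ln (INR (b j))) * / INR (Q j) <= 2 * ((1 + ln (INR (b j))) * / INR (Q j)))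
      by nra.
    lra.
Qed.

Lemma log_sum_ge0 : 0 <= log_sum.
Proof.
  apply sumN_ge0; intros i Hi; pose proof (ln_pquot_ge0 (S i) ltac:(lia)).
  rewrite cf_a_pquot by lia. unfold Rdiv.
  repeat apply Rmult_le_pos; [lra|apply pos_INR|].
  left; apply Rinv_0_lt_compat, lt_0_INR; pose proof (qden_pos k); lia.
Qed.

Lemma P_convergent_estimate :
  let E := (20 * log_sum + 1) / cf_a alpha (S k) in
  1024 * E <= 1 -> forall x,
  Rabs (P (cf_q alpha k) alpha ((-1) ^ k * x / INR (cf_q alpha k)) - Rabs (2 * sin (PI * x)))
  <= 3000 * E.
Proof.
  intros E HE x; rewrite cf_q_qden.
  destruct (convergent_data k) as (p & p' & s & delta & Hs & Es & D & Dp & E1 & E2).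
  rewrite <- Es.
  pose proof log_sum_ge0 as L0; pose proof (cf_a_ge_1 (S k) ltac:(lia)) as A1.
  pose proof (qden_pos k) as Kp.
  assert (K1 : 1 <= INR (qden (S k))) by (apply (le_INR 1); assumption).
  assert (Eta : INR (qden (S k)) * delta * cf_a alpha (S k) <= 1).
  (* The determinant identity with [p] and [p'] eliminated; it yields [eta <= 1 / a_(k+1)]. *)
  { assert (Det : INR (qden (S k)) * (delta * cf_x alpha (S k)) + INR (qden k) * delta = 1).
    { assert (DR : IZR p * INR (qden k) - IZR p' * INR (qden (S k)) = - IZR s).
      { rewrite !INR_IZR_INZ, <- !mult_IZR, <- minus_IZR, <- opp_IZR, D; reflexivity. }
      assert (SR : IZR s * IZR s = 1) by (destruct Hs as [-> | ->]; lra).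
      transitivity (IZR s * IZR s
        * (INR (qden (S k)) * (delta * cf_x alpha (S k)) + INR (qden k) * delta));
        [rewrite SR; ring|].
      transitivity (IZR s * (INR (qden k) * (IZR s * delta)
        - INR (qden (S k)) * - (IZR s * (delta * cf_x alpha (S k))))); [ring|].
      rewrite <- E1, <- E2.
      transitivity (- (IZR s * (IZR p * INR (qden k) - IZR p' * INR (qden (S k))))); [ring|].
      rewrite DR; lra. }
    assert (0 <= INR (qden k) * delta) by (apply Rmult_le_pos; [apply pos_INR|lra]).
    pose proof (base_Int_part (cf_x alpha (S k))) as B.
    assert (cf_a alpha (S k) <= cf_x alpha (S k)) by (unfold cf_a, floorR; lra).
    assert (INR (qden (S k)) * delta * cf_a alpha (S k)
      <= INR (qden (S k)) * delta * cf_x alpha (S k)) by (apply Rmult_le_compat_l; nra).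
    lra. }
  assert (EE : INR (qden (S k)) * delta * (20 * log_sum + 1) <= E).
  { unfold E; apply Rmult_le_reg_r with (cf_a alpha (S k)); [lra|].
    replace ((20 * log_sum + 1) / cf_a alpha (S k) * cf_a alpha (S k))
      with (20 * log_sum + 1) by (field; lra). nra. }
  eapply Rle_trans;
    [apply (P_estimate alpha delta (20 * log_sum) (qden (S k)) p (Z.of_nat (qden k)) p' s);
      try assumption; try lra|lra].
  rewrite <- INR_IZR_INZ; apply reversed_discrepancy.
Qed.

End Reversed.

End Expansion.

(** * Bounds for the logarithmic sum and passage to the limit *)

Section LogSumBounds.

Variable alpha : R.
Hypothesis alpha_irr : irrational alpha.

Lemma log_sum_le k M : (forall l, (1 <= l <= k)%nat -> 1 + ln (cf_a alpha l) <= M) -> 0 <= M ->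
  log_sum alpha k <= 3 * M.
Proof.
  intros HM M0.
  assert (K : 0 < INR (qden alpha (S k)))
    by (apply lt_0_INR; pose proof (qden_pos alpha alpha_irr k); lia).
  assert (I : 0 < / INR (qden alpha (S k))) by (apply Rinv_0_lt_compat; assumption).
  apply Rle_trans with
    (M * / INR (qden alpha (S k)) * sumN (fun i => INR (qden alpha (S (S i)))) k).
  - rewrite <- sumN_scal; apply sumN_le; intros i Hi.
    unfold Rdiv; rewrite !Rmult_assoc, (Rmult_comm (/ _)).
    apply Rmult_le_compat_r; [apply Rmult_le_pos; [apply pos_INR|lra]|apply HM; lia].
  - pose proof (sum_qden_le alpha alpha_irr k) as SQ.
    apply Rle_trans with (M * / INR (qden alpha (S k)) * (3 * INR (qden alpha (S k)))).
    + apply Rmult_le_compat_l; [apply Rmult_le_pos; lra|assumption].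
    + right; field; lra.
Qed.

(* For [l < k], [q_l (1 + log a_l) <= W q_l a_(l+1) <= W q_(l+1)]. *)
Lemma log_sum_le_last k W : 0 <= W ->
  (forall l, (1 <= l)%nat -> (1 + ln (cf_a alpha l)) / cf_a alpha (S l) <= W) ->
  log_sum alpha (S k) <= 3 * W + (1 + ln (cf_a alpha (S k))).
Proof.
  intros W0 HW; unfold log_sum; cbn [sumN].
  set (K := INR (qden alpha (S (S k)))).
  assert (K0 : 0 < K)
    by (apply lt_0_INR; pose proof (qden_pos alpha alpha_irr (S k)); lia).
  assert (I : 0 < / K) by (apply Rinv_0_lt_compat; assumption).
  (* The last term has ratio 1 and is kept apart; it is compared with the next partial quotient only
     in the limit. *)
  replace ((1 + ln (cf_a alpha (S k))) * K / K) with (1 + ln (cf_a alpha (S k)))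
    by (field; lra).
  apply Rplus_le_compat_r.
  apply Rle_trans with
    (W * / K * sumN (fun i => INR (qden alpha (S (S i)))) (S k)).
  - apply Rle_trans with (W * / K * sumN (fun i => INR (qden alpha (S (S (S i))))) k).
    + rewrite <- sumN_scal; apply sumN_le; intros i Hi.
      pose proof (cf_a_ge_1 alpha alpha_irr (S (S i)) ltac:(lia)) as A1.
      specialize (HW (S i) ltac:(lia)).
      assert (HW' : 1 + ln (cf_a alpha (S i)) <= W * cf_a alpha (S (S i))).
      { apply Rmult_le_reg_r with (/ cf_a alpha (S (S i)));
          [apply Rinv_0_lt_compat; lra|].
        rewrite Rmult_assoc, Rinv_r, Rmult_1_r by lra. exact HW. }
      assert (Q : cf_a alpha (S (S i)) * INR (qden alpha (S (S i)))
        <= INR (qden alpha (S (S (S i))))).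
      { rewrite cf_a_pquot, <- mult_INR, (qden_SS alpha (S i)) by (assumption || lia).
        apply le_INR; lia. }
      pose proof (pos_INR (qden alpha (S (S i)))) as q0.
      unfold Rdiv; rewrite Rmult_assoc, (Rmult_comm _ (/ K)), <- Rmult_assoc,
        (Rmult_comm _ (/ K)), (Rmult_comm W), !Rmult_assoc.
      apply Rmult_le_compat_l; [lra|]. nra.
    + apply Rmult_le_compat_l; [apply Rmult_le_pos; lra|].
      change (S k) with (1 + k)%nat; rewrite sumN_add; cbn [sumN Nat.add].
      pose proof (pos_INR (qden alpha 2)); lra.
  - pose proof (sum_qden_le alpha alpha_irr (S k)) as SQ; fold K in SQ.
    apply Rle_trans with (W * / K * (3 * K)).
    + apply Rmult_le_compat_l; [apply Rmult_le_pos; lra|assumption].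
    + right; field; lra.
Qed.

Lemma cf_a_le_amax k l : (1 <= l <= k)%nat -> cf_a alpha l <= cf_amax alpha k.
Proof.
  induction k as [|k IH]; intros H; [lia|].
  destruct k as [|k]; [replace l with 1%nat by lia; cbn [cf_amax]; lra|].
  change (cf_a alpha l <= Rmax (cf_amax alpha (S k)) (cf_a alpha (S (S k)))).
  destruct (Nat.eq_dec l (S (S k))) as [-> |N]; [apply Rmax_r|].
  eapply Rle_trans; [apply IH; lia|apply Rmax_l].
Qed.

Lemma loc_unif_cv_of_log_sum (km : nat -> nat) (e : nat -> R) (C : R) :
  0 < C -> Un_cv e 0 ->
  (forall m, (1 <= m)%nat ->
     (20 * log_sum alpha (km m) + 1) / cf_a alpha (S (km m)) <= C * e m) ->
  loc_unif_cv
    (fun m x => P (cf_q alpha (km m)) alpha ((-1) ^ (km m) * x / INR (cf_q alpha (km m))))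
    (fun x => Rabs (2 * sin (PI * x))).
Proof.
  intros HC He HE M eps Heps.
  (* The first entry meets the smallness condition of the estimate, the second makes
     [3000 d < eps]. *)
  set (d := Rmin (/ 1024) (eps / 4000)).
  assert (Hd : 0 < d) by (apply Rmin_glb_lt; lra).
  destruct (He (d / C)) as [N HN]; [apply Rdiv_lt_0_compat; assumption|].
  exists (S N); intros m Hm x _.
  specialize (HN m ltac:(lia)); unfold R_dist in HN; rewrite Rminus_0_r in HN.
  pose proof (Rle_abs (e m)).
  assert (EC : C * e m <= d).
  { replace d with (C * (d / C)) by (field; lra). apply Rmult_le_compat_l; lra. }
  specialize (HE m ltac:(lia)).
  pose proof (Rmin_l (/ 1024) (eps / 4000)) as D1; fold d in D1.
  pose proof (Rmin_r (/ 1024) (eps / 4000)) as D2; fold d in D2.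
  eapply Rle_lt_trans; [apply P_convergent_estimate; [assumption|lra]|lra].
Qed.

End LogSumBounds.

Theorem theorem5 (alpha : R) :
  irrational alpha ->
  (forall B : R, exists k : nat, (1 <= k)%nat /\ B < cf_a alpha k) ->
  (forall km : nat -> nat,
     (forall m, (1 <= km m)%nat) ->
     (forall m, (km m < km (S m))%nat) ->
     Un_cv (fun m => (1 + ln (cf_amax alpha (km m))) / cf_a alpha (S (km m))) 0 ->
     loc_unif_cv
       (fun m x => P (cf_q alpha (km m)) alpha ((-1) ^ (km m) * x / INR (cf_q alpha (km m))))
       (fun x => Rabs (2 * sin (PI * x))))
  /\
  (Un_cv (fun k => (1 + ln (cf_a alpha k)) / cf_a alpha (S k)) 0 ->
     loc_unif_cv
       (fun m x => P (cf_q alpha m) alpha ((-1) ^ m * x / INR (cf_q alpha m)))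
       (fun x => Rabs (2 * sin (PI * x)))).
Proof.
  intros irr _.
  assert (LN : forall l, (1 <= l)%nat -> 0 <= ln (cf_a alpha l)).
  { intros l Hl; rewrite cf_a_pquot by assumption; apply ln_pquot_ge0; assumption. }
  split.
  - intros km km1 _ Hcv.
    (* With [M = 1 + log max a_l >= 1], [20 (3 M) + 1 <= 61 M]. *)
    apply (loc_unif_cv_of_log_sum alpha irr km _ 61 ltac:(lra) Hcv); intros m _.
    pose proof (cf_a_ge_1 alpha irr (S (km m)) ltac:(lia)) as A1.
    specialize (km1 m).
    assert (LM : forall l, (1 <= l <= km m)%nat ->
      1 + ln (cf_a alpha l) <= 1 + ln (cf_amax alpha (km m))).
    { intros l Hl; apply Rplus_le_compat_l, ln_le; [|apply cf_a_le_amax; assumption].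
      pose proof (cf_a_ge_1 alpha irr l ltac:(lia)); lra. }
    pose proof (LM 1%nat ltac:(lia)) as L1; pose proof (LN 1%nat ltac:(lia)).
    pose proof (log_sum_le alpha irr (km m) _ LM ltac:(lra)) as B.
    unfold Rdiv; rewrite <- Rmult_assoc; apply Rmult_le_compat_r; [|lra].
    left; apply Rinv_0_lt_compat; lra.
  - intros Hcv.
    (* A convergent sequence is bounded; [W] controls all terms but the last, and
       [20 (3 W + u) + 1 <= (60 W + 21) u] for [u = 1 + log a_k >= 1]. *)
    destruct (maj_by_pos _ (exist _ 0 Hcv)) as [W [W0 HW]].
    apply (loc_unif_cv_of_log_sum alpha irr (fun m => m) _ (60 * W + 21) ltac:(lra) Hcv).
    intros [|k] Hk; [lia|].
    pose proof (cf_a_ge_1 alpha irr (S (S k)) ltac:(lia)) as A1.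
    pose proof (log_sum_le_last alpha irr k W ltac:(lra)) as B.
    specialize (B (fun l _ => Rle_trans _ _ _ (Rle_abs _) (HW l))).
    pose proof (LN (S k) ltac:(lia)).
    unfold Rdiv; rewrite <- Rmult_assoc; apply Rmult_le_compat_r; [|nra].
    left; apply Rinv_0_lt_compat; lra.
Qed.
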